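(* Let $\alpha,\beta$ be two nonconstant inner functions and let $\varphi\in L^2(\partial\mathbb{D})$ be such that the asymmetric truncated Toeplitz operator $A^{\alpha,\beta}_{\varphi}\colon K_\alpha\to K_\beta$ is bounded. Then $A^{\alpha,\beta}_{\varphi}=0$ if and only if $\varphi\in \overline{\alpha H^2}+\beta H^2$, i.e. $\varphi=\overline{\alpha h_1}+\beta h_2$ for some $h_1,h_2\in H^2$.
   Context: $H^2$ is the Hardy space of the unit disk $\mathbb{D}$, identified via boundary values with the closed subspace of $L^2(\partial\mathbb{D})$ of functions with vanishing negative Fourier coefficients; $H^\infty$ is the algebra of bounded analytic functions on $\mathbb{D}$. An inner function is $\alpha\in H^\infty$ with $|\alpha|=1$ a.e. on $\partial\mathbb{D}$. The model space is $K_\alpha=H^2\ominus\alpha H^2$, with reproducing kernel $k_w^\alpha(z)=\frac{1-\overline{\alpha(w)}\alpha(z)}{1-\overline{w}z}$, and $K_\alpha^\infty=K_\alpha\cap H^\infty$ (dense in $K_\alpha$). $P_\beta$ is the orthogonal projection of $L^2(\partial\mathbb{D})$ onto $K_\beta$, extended to $f\in L^1(\partial\mathbb{D})$ by $P_\beta f(z)=\langle f,k_z^\beta\rangle$ (an analytic function on $\mathbb{D}$). For inner $\alpha,\beta$ and $\varphi\in L^2(\partial\mathbb{D})$, the asymmetric truncated Toeplitz operator $A^{\alpha,\beta}_\varphi$ is the densely defined operator $A^{\alpha,\beta}_\varphi f=P_\beta(\varphi f)$, $f\in K_\alpha^\infty$; it is called bounded if it extends to a bounded operator $K_\alpha\to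 K_\beta$. *)

(* Defs.v *)
From HB Require Import structures.
From mathcomp Require Import all_boot all_order all_algebra.
From mathcomp Require Import all_classical all_reals all_analysis.
From mathcomp Require Import complex.
Set Implicit Arguments. Unset Strict Implicit. Unset Printing Implicit Defensive.
Import Order.TTheory GRing.Theory Num.Theory.
Local Open Scope classical_set_scope.
Local Open Scope ring_scope.

Section Hardy.
Variable R : realType.
Local Notation C := R[i].

(* The unit circle is parametrised by t in [0, 2pi], zeta = e^{it};
   a function on the circle is a function f : R -> C, only its values
   on [0, 2pi] matter. *)
Definition circ : set R := `[0%R, (2 * pi)%R].
Definition leb := (@lebesgue_measure R).

Definition cre (z : C) : R := let: Complex a _ := z in a.
Definition cim (z : C) : R := let: Complex _ b := z in b.
Definition csq (z : C) : R := cre z ^+ 2 + cim z ^+ 2.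

Definition echar (n : int) (t : R) : C :=
  Complex (cos (n%:~R * t)) (sin (n%:~R * t)).
Definition ept (t : R) : C := echar 1 t.

Definition ae_circ (P : R -> Prop) : Prop :=
  leb.-negligible (circ `&` [set t | ~ P t]).

Definition cmeas (f : R -> C) : Prop :=
  measurable_fun circ (fun t => cre (f t)) /\ measurable_fun circ (fun t => cim (f t)).

Definition cint (f : R -> C) : C :=
  Complex (Rintegral leb circ (fun t => cre (f t)))
          (Rintegral leb circ (fun t => cim (f t))).

Definition L1 (f : R -> C) : Prop :=
  cmeas f /\ leb.-integrable circ (fun t => (Num.sqrt (csq (f t)))%:E).
Definition L2 (f : R -> C) : Prop :=
  cmeas f /\ leb.-integrable circ (fun t => (csq (f t))%:E).
Definition Linf (f : R -> C) : Prop :=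
  cmeas f /\ exists M : R, ae_circ (fun t => csq (f t) <= M).

Definition ip (f g : R -> C) : C :=
  ((2 * pi)^-1)%:C%C * cint (fun t => f t * conjc (g t)).
Definition fcoef (f : R -> C) (n : int) : C := ip f (echar n).
Definition sqnorm (f : R -> C) : R := (2 * pi)^-1 * Rintegral leb circ (fun t => csq (f t)).

(* H^2 and H^infty, via boundary values *)
Definition H2 (f : R -> C) : Prop := L2 f /\ forall n : int, n < 0 -> fcoef f n = 0.
Definition Hinf (f : R -> C) : Prop := Linf f /\ forall n : int, n < 0 -> fcoef f n = 0.

Definition inner (a : R -> C) : Prop := Hinf a /\ ae_circ (fun t => csq (a t) = 1).
Definition nonconstant (a : R -> C) : Prop := ~ exists c : C, ae_circ (fun t => a t = c).

Definition disk : set C := [set z | csq z < 1].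

(* value at z in the disk of (the analytic extension of) f:
   <f, k_z> with Szego kernel k_z(zeta) = 1/(1 - conj(z) zeta) *)
Definition ext (f : R -> C) (z : C) : C := ip f (fun t => (1 - conjc z * ept t)^-1).

Definition Kmodel (a f : R -> C) : Prop :=
  H2 f /\ forall g, H2 g -> ip f (fun t => a t * g t) = 0.
Definition Kinf (a f : R -> C) : Prop := Kmodel a f /\ Linf f.

Definition rkernel (b : R -> C) (w : C) : R -> C :=
  fun t => (1 - conjc (ext b w) * b t) / (1 - conjc w * ept t).

(* P_b g (w) = <g, k_w^b>, an analytic function on the disk *)
Definition Pmodel (b g : R -> C) (w : C) : C := ip g (rkernel b w).

Definition ATTO (a b phi f : R -> C) : C -> C := Pmodel b (fun t => phi t * f t).

(* A^{a,b}_phi extends to a bounded operator K_a -> K_b: there is a constant M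
   such that for every f in K_a^infty, A f is (the analytic extension of)
   some h in K_b with ||h||^2 <= M ||f||^2. *)
Definition ATTO_bounded (a b phi : R -> C) : Prop :=
  exists M : R, forall f, Kinf a f ->
    exists h, Kmodel b h /\ (forall w, disk w -> ATTO a b phi f w = ext h w) /\
              sqnorm h <= M * sqnorm f.

(* A^{a,b}_phi = 0 (on its dense domain, hence its bounded extension is 0) *)
Definition ATTO_zero (a b phi : R -> C) : Prop :=
  forall f, Kinf a f -> forall w, disk w -> ATTO a b phi f w = 0.

End Hardy.

(* Main.v *)
(* On the circle, [conj z = 1/z], so a function of L^2 splits as [f + conj (z u)]
   with [f], [u] in H^2. The splitting is obtained from three facts: L^2 is complete,
   analytic partial Fourier sums are Cauchy, and a function of L^2 with vanishing Fourier
   coefficients is zero (indicators of arcs starting at 1 are bounded pointwise limits of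
   trigonometric polynomials, and Lebesgue differentiation concludes). Hence polynomials
   are dense in H^2, which gives [H^infty H^2 <= H^2] and the multiplicativity of the
   analytic extension.

   If A = 0, put [a = alpha(0)], [b = beta(0)], so that [k_0^alpha = 1 - conj a alpha] and
   [k_0^beta = 1 - conj b beta]. Since [phi k_0^alpha] is orthogonal to all [k_w^beta], and
   [conj phi k_0^beta] to all [k_w^alpha],
     [phi (1 - conj a alpha) = conj (z u) + beta v] and
     [phi (1 - b conj beta) = z u' + conj (alpha v')].
   Multiplying crosswise, [(beta - b) v - z u' (1 - conj a alpha)] is both analytic and
   antianalytic, and vanishes at 0, hence is 0. Dividing,
     [phi = beta v / (1 - conj a alpha) + conj (alpha v' / (1 - conj b beta))],
   where the quotients are in H^2 because [|a|, |b| < 1].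

   Conversely, for [f] bounded in [K_alpha] and [k = k_w^beta], the part [conj (alpha h1)]
   contributes [<f, alpha (h1 k)> = 0], and [beta h2] contributes [<beta (h2 f), k> = 0]. *)
Require Import Defs.
From HB Require Import structures.
From mathcomp Require Import all_boot all_order all_algebra.
From mathcomp Require Import all_classical all_reals all_analysis.
From mathcomp Require Import measurable_realfun complex ring lra zify.
Set Implicit Arguments. Unset Strict Implicit. Unset Printing Implicit Defensive.
Import Order.TTheory GRing.Theory Num.Theory.
Import numFieldNormedType.Exports.
Local Open Scope ring_scope.

(** * Complex numbers through real and imaginary parts; characters of the circle *)

Section ComplexBasics.
Local Open Scope classical_set_scope.
Local Open Scope ring_scope.
Context {R : realType}.
Local Notation C := R[i].
Implicit Types (x y : C).

Lemma creD x y : cre (x + y) = cre x + cre y. Proof. by case: x; case: y. Qed.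
Lemma cimD x y : cim (x + y) = cim x + cim y. Proof. by case: x; case: y. Qed.
Lemma creM x y : cre (x * y) = cre x * cre y - cim x * cim y.
Proof. by case: x; case: y. Qed.
Lemma cimM x y : cim (x * y) = cre x * cim y + cim x * cre y.
Proof. by case: x => a b; case: y => c d. Qed.
Lemma creN x : cre (- x) = - cre x. Proof. by case: x. Qed.
Lemma cimN x : cim (- x) = - cim x. Proof. by case: x. Qed.
Lemma creJ x : cre (conjc x) = cre x. Proof. by case: x. Qed.
Lemma cimJ x : cim (conjc x) = - cim x. Proof. by case: x. Qed.
Lemma creV x : cre x^-1 = cre x * (csq x)^-1. Proof. by case: x. Qed.
Lemma cimV x : cim x^-1 = - (cim x * (csq x)^-1). Proof. by case: x. Qed.
Lemma creR (a : R) : cre (a%:C)%C = a. Proof. by []. Qed.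
Lemma cimR (a : R) : cim (a%:C)%C = 0. Proof. by []. Qed.

Lemma complex_ext x y : cre x = cre y -> cim x = cim y -> x = y.
Proof. by case: x => a b; case: y => c d /= -> ->. Qed.

Lemma conjD x y : conjc (x + y) = conjc x + conjc y. Proof. exact: rmorphD. Qed.
Lemma conjN x : conjc (- x) = - conjc x. Proof. exact: rmorphN. Qed.
Lemma conjM x y : conjc (x * y) = conjc x * conjc y. Proof. exact: rmorphM. Qed.

Lemma csqE x : x * conjc x = (csq x)%:C%C.
Proof.
by apply: complex_ext; rewrite (creM, cimM) creJ cimJ (creR, cimR) /csq; ring.
Qed.

Lemma csqM x y : csq (x * y) = csq x * csq y.
Proof. by rewrite /csq creM cimM; ring. Qed.

Lemma csqN x : csq (- x) = csq x.
Proof. by rewrite /csq creN cimN; ring. Qed.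

Lemma csqJ x : csq (conjc x) = csq x.
Proof. by rewrite /csq creJ cimJ; ring. Qed.

Lemma csq_ge0 x : 0 <= csq x.
Proof. by rewrite addr_ge0// sqr_ge0. Qed.

Lemma csqD_le x y : csq (x + y) <= 2 * (csq x + csq y).
Proof.
rewrite /csq creD cimD.
have := sqr_ge0 (cre x - cre y); have := sqr_ge0 (cim x - cim y); nra.
Qed.

Lemma csq_eq0 x : csq x = 0 -> x = 0.
Proof.
move=> /eqP; rewrite paddr_eq0 ?sqr_ge0// !sqrf_eq0 => /andP[/eqP a /eqP b].
exact: complex_ext.
Qed.

Lemma csq0 : csq (0 : C) = 0. Proof. by rewrite /csq /= expr0n addr0. Qed.

Lemma csq1 : csq (1 : C) = 1. Proof. by rewrite /csq /= expr1n expr0n addr0. Qed.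

Lemma csqX x n : csq (x ^+ n) = csq x ^+ n.
Proof. by elim: n => [|n IH]; rewrite ?csq1// !exprS csqM IH. Qed.

Lemma csqV x : csq x^-1 = (csq x)^-1.
Proof.
have [->|x0] := eqVneq x 0; first by rewrite invr0 csq0 invr0.
have h : csq x * csq x^-1 = 1 by rewrite -csqM mulfV// csq1.
have c0 : csq x != 0 by apply: contra_neq x0 => /csq_eq0.
by apply: (mulfI c0); rewrite h mulfV.
Qed.

Lemma csq_real (a : R) : csq (a%:C)%C = a ^+ 2.
Proof. by rewrite /csq /= expr0n addr0. Qed.

(** From [2 Re x <= 1 + |x|^2] one gets [1 - Re x >= (1 - q) / 2], a bound free of square roots. It
    keeps the denominators [1 - c theta] of the kernels away from 0. *)
Lemma csq1B_ge (q : R) x : csq x <= q -> q < 1 -> ((1 - q) / 2) ^+ 2 <= csq (1 - x).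
Proof.
rewrite /csq creD cimD creN cimN /= => xq q1.
have h : (1 - q) / 2 <= 1 - cre x.
  have := sqr_ge0 (cre x - 1); have := sqr_ge0 (cim x); nra.
have := sqr_ge0 (0 - cim x); nra.
Qed.

Lemma csq_echar n (t : R) : csq (echar n t) = 1.
Proof. by rewrite /csq /= cos2Dsin2. Qed.

Lemma echarD n m (t : R) : echar (n + m) t = echar n t * echar m t.
Proof.
apply: complex_ext; rewrite (creM, cimM) /= rmorphD mulrDl ?cosD ?sinD//; ring.
Qed.

Lemma echarN n (t : R) : echar (- n) t = conjc (echar n t).
Proof. by rewrite /echar /= rmorphN /= mulNr cosN sinN. Qed.

Lemma echar0 (t : R) : echar 0 t = 1.
Proof. by rewrite /echar mul0r cos0 sin0. Qed.

End ComplexBasics.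

(** * Null sets, measurability and normalized integrals on the circle *)

Section CircleIntegral.
Local Open Scope classical_set_scope.
Local Open Scope ring_scope.
Context {R : realType}.
Local Notation C := R[i].
Local Notation mu := (@leb R).
Local Notation T := (@circ R).
Implicit Types (f g : R -> C) (P Q : R -> Prop).

Lemma measurable_circ : measurable T.
Proof. exact: measurable_itv. Qed.
#[local] Hint Extern 0 (measurable _) => solve [exact: measurable_circ] : core.

Lemma circ_lty : (mu T < +oo)%E.
Proof.
by apply: compact_finite_measure; exact: segment_compact.
Qed.

Lemma ae_circE P : ae_circ P <-> {ae mu, forall t, T t -> P t}.
Proof.
suff -> : ae_circ P = {ae mu, forall t, T t -> P t} by [].
rewrite /ae_circ /almost_everywhere/=; congr (_.-negligible _).
by apply/seteqP; split=> t /= => [[a b] /(_ a)//|/not_implyP].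
Qed.

Lemma ae_circ_sub P Q : ae_circ P -> (forall t, P t -> Q t) -> ae_circ Q.
Proof.
by move=> aP PQ; apply: negligibleS aP => t [a b]; split => //; apply: contra_not b; exact: PQ.
Qed.

Lemma ae_circ_and P Q : ae_circ P -> ae_circ Q -> ae_circ (fun t => P t /\ Q t).
Proof.
move=> aP aQ; apply: negligibleS (negligibleU aP aQ) => t [a /= b].
have [p|p] := pselect (P t); last by left.
by right; split => // q; apply: b.
Qed.

Lemma ae_circ_sub2 P Q S : ae_circ P -> ae_circ Q ->
  (forall t, P t -> Q t -> S t) -> ae_circ S.
Proof. by move=> aP aQ PQ; apply: ae_circ_sub (ae_circ_and aP aQ) _ => t [/PQ]; apply. Qed.

Lemma ae_circT P : (forall t, P t) -> ae_circ P.
Proof.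
move=> PT; rewrite /ae_circ; suff -> : T `&` [set t | ~ P t] = set0 by exact: negligible_set0.
by apply/seteqP; split => // t [_ /=]; apply.
Qed.

Lemma cmeas_cst (c : C) : cmeas (fun _ : R => c).
Proof. by split; exact: measurable_cst. Qed.

Lemma cmeas_add f g : cmeas f -> cmeas g -> cmeas (fun t => f t + g t).
Proof.
move=> [f1 f2] [g1 g2]; split.
  by under eq_fun do rewrite creD; exact: measurable_funD.
by under eq_fun do rewrite cimD; exact: measurable_funD.
Qed.

Lemma cmeas_mul f g : cmeas f -> cmeas g -> cmeas (fun t => f t * g t).
Proof.
move=> [f1 f2] [g1 g2]; split.
  by under eq_fun do rewrite creM; apply: measurable_funB; exact: measurable_funM.
by under eq_fun do rewrite cimM; apply: measurable_funD; exact: measurable_funM.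
Qed.

Lemma cmeas_conj f : cmeas f -> cmeas (fun t => conjc (f t)).
Proof.
move=> [f1 f2]; split; first by under eq_fun do rewrite creJ.
by under eq_fun do rewrite cimJ; exact: measurable_funN.
Qed.

Lemma cmeas_opp f : cmeas f -> cmeas (fun t => - f t).
Proof.
move=> [f1 f2]; split.
  by under eq_fun do rewrite creN; exact: measurable_funN.
by under eq_fun do rewrite cimN; exact: measurable_funN.
Qed.

Lemma measurable_csq f : cmeas f -> measurable_fun T (fun t => csq (f t)).
Proof. by move=> [f1 f2]; apply: measurable_funD; exact: measurable_funX. Qed.

Lemma cmeas_inv f : cmeas f -> cmeas (fun t => (f t)^-1).
Proof.
move=> mf; have [f1 f2] := mf.
have mV : measurable_fun T (fun t => (csq (f t))^-1).
  under eq_fun do rewrite -powR_inv1 ?csq_ge0//.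
  by apply: (@measurableT_comp _ _ _ _ _ _ (@powR R ^~ (-1))); [exact: measurable_powR|exact: measurable_csq].
split.
  by under eq_fun do rewrite creV; exact: measurable_funM.
by under eq_fun do rewrite cimV; apply: measurable_funN; exact: measurable_funM.
Qed.

Lemma cmeas_echar n : cmeas (@echar R n).
Proof.
have cm : continuous (fun t : R => n%:~R * t) by exact: mulrl_continuous.
have cc : continuous (fun t : R => cos (n%:~R * t)).
  by move=> x; apply: continuous_comp; [exact: cm|exact: continuous_cos].
have cs : continuous (fun t : R => sin (n%:~R * t)).
  by move=> x; apply: continuous_comp; [exact: cm|exact: continuous_sin].
by split; apply: measurable_funTS; exact: continuous_measurable_fun.
Qed.

Definition integ f := mu.-integrable T (fun t => (cre (f t))%:E) /\
  mu.-integrable T (fun t => (cim (f t))%:E).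

Lemma integ_meas f : integ f -> cmeas f.
Proof.
by move=> [/integrableP[/measurable_EFinP ? _] /integrableP[/measurable_EFinP ? _]].
Qed.

Lemma integrable_ae_eq (f g : R -> R) : mu.-integrable T (EFin \o f) ->
  measurable_fun T g -> ae_circ (fun t => f t = g t) ->
  mu.-integrable T (EFin \o g) /\
  Rintegral mu T f = Rintegral mu T g.
Proof.
move=> /integrableP[mf fi] mg fg.
have mg' : measurable_fun T (EFin \o g) by apply/measurable_EFinP.
split; last first.
  congr fine; apply: ae_eq_integral => //.
  by apply/(ae_circE (fun t => _ = _)).1/(ae_circ_sub fg) => t /= ->.
apply/integrableP; split => //; apply: le_lt_trans fi.
apply: ae_ge0_le_integral => //; [exact: measurableT_comp|exact: measurableT_comp|].
by apply/(ae_circE (fun t => is_true _)).1/(ae_circ_sub fg) => t /= ->.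
Qed.

Definition mean f : C := ((2 * pi)^-1)%:C%C * cint f.

Lemma ipE f g : ip f g = mean (fun t => f t * conjc (g t)).
Proof. by []. Qed.

Lemma eq_mean f g : f =1 g -> mean f = mean g.
Proof. by move=> /funext ->. Qed.

Lemma mean_ae f g : integ f -> cmeas g -> ae_circ (fun t => f t = g t) ->
  mean f = mean g.
Proof.
move=> [f1 f2] [g1 g2] fg; rewrite /mean; congr (_ * _); apply: complex_ext.
  by apply: (integrable_ae_eq f1 g1 (ae_circ_sub fg _)).2 => t /= ->.
by apply: (integrable_ae_eq f2 g2 (ae_circ_sub fg _)).2 => t /= ->.
Qed.

Lemma integ_add f g : integ f -> integ g -> integ (fun t => f t + g t).
Proof.
move=> [f1 f2] [g1 g2]; split.
  under eq_fun do rewrite creD EFinD; exact: integrableD.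
under eq_fun do rewrite cimD EFinD; exact: integrableD.
Qed.

Lemma integ_scale (c : C) f : integ f -> integ (fun t => c * f t).
Proof.
move=> [f1 f2]; split.
  under eq_fun do rewrite creM EFinB !EFinM.
  by apply: integrableB => //; exact: integrableZl.
under eq_fun do rewrite cimM EFinD !EFinM.
by apply: integrableD => //; exact: integrableZl.
Qed.

Lemma integ_conj f : integ f -> integ (fun t => conjc (f t)).
Proof.
move=> [f1 f2]; split; first by under eq_fun do rewrite creJ.
under eq_fun do rewrite cimJ EFinN.
exact: integrableN.
Qed.

Lemma meanD f g : integ f -> integ g -> mean (fun t => f t + g t) = mean f + mean g.
Proof.
move=> [f1 f2] [g1 g2]; rewrite /mean -mulrDr; congr (_ * _); apply: complex_ext.
  rewrite creD /= -RintegralD//; apply: eq_Rintegral => t _; exact: creD.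
rewrite cimD /= -RintegralD//; apply: eq_Rintegral => t _; exact: cimD.
Qed.

Lemma meanZ (c : C) f : integ f -> mean (fun t => c * f t) = c * mean f.
Proof.
move=> [f1 f2]; rewrite /mean mulrCA; congr (_ * _).
have z1 (k : R) : mu.-integrable T (EFin \o (fun t => k * cre (f t))).
  exact: (integrableZl _ k f1).
have z2 (k : R) : mu.-integrable T (EFin \o (fun t => k * cim (f t))).
  exact: (integrableZl _ k f2).
apply: complex_ext.
  rewrite creM /= -!RintegralZl// -RintegralB//.
  by apply: eq_Rintegral => t _; exact: creM.
rewrite cimM /= -!RintegralZl// -RintegralD//.
by apply: eq_Rintegral => t _; exact: cimM.
Qed.

Lemma mean_conj f : integ f -> mean (fun t => conjc (f t)) = conjc (mean f).
Proof.
move=> [f1 f2]; rewrite /mean [RHS]rmorphM; congr (_ * _).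
  by apply: complex_ext; rewrite ?creJ ?cimJ //= oppr0.
apply: complex_ext; rewrite ?creJ ?cimJ /=.
  by apply: eq_Rintegral => t _; exact: creJ.
rewrite -mulN1r -RintegralZl//.
by apply: eq_Rintegral => t _; rewrite cimJ mulN1r.
Qed.

End CircleIntegral.

#[local] Hint Extern 0 (measurable _) => solve [exact: measurable_circ] : core.

(** * Bounded and square-integrable functions on the circle *)

Section Spaces.
Local Open Scope classical_set_scope.
Local Open Scope ring_scope.
Context {R : realType}.
Local Notation C := R[i].
Local Notation mu := (@leb R).
Local Notation T := (@circ R).
Implicit Types (f g : R -> C).

Lemma integrable_le_ae (f g : R -> R) : measurable_fun T f ->
  mu.-integrable T (EFin \o g) -> ae_circ (fun t => `|f t| <= g t) ->
  mu.-integrable T (EFin \o f).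
Proof.
move=> mf /integrableP[mg fg] le; apply/integrableP.
have mf' : measurable_fun T (EFin \o f) by apply/measurable_EFinP.
split => //; apply: le_lt_trans fg.
apply: ae_ge0_le_integral => //; [exact: measurableT_comp|exact: measurableT_comp|].
apply/(ae_circE (fun t => is_true _)).1/(ae_circ_sub le) => t /= ft.
by rewrite lee_fin (le_trans ft)// ler_norm.
Qed.

Lemma integrable_cst_circ (c : R) : mu.-integrable T (EFin \o (fun=> c)).
Proof.
apply: measurable_bounded_integrable => //; first exact: circ_lty.
by exists `|c|; split; rewrite ?num_real// => x xc y _ /=; exact: ltW.
Qed.

Lemma Linf_cst (c : C) : Linf (fun _ : R => c).
Proof. by split; [exact: cmeas_cst|exists (csq c); exact: ae_circT]. Qed.

Lemma Linf_echar n : Linf (@echar R n).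
Proof.
by split; [exact: cmeas_echar|exists 1; apply: ae_circT => t; rewrite csq_echar].
Qed.

Lemma Linf_add f g : Linf f -> Linf g -> Linf (fun t => f t + g t).
Proof.
move=> [mf [M fM]] [mg [N gN]]; split; first exact: cmeas_add.
exists (2 * (M + N)); apply: ae_circ_sub2 fM gN _ => t fM gN.
by apply: le_trans (csqD_le _ _) _; rewrite ler_pM2l// lerD.
Qed.

Lemma Linf_mul f g : Linf f -> Linf g -> Linf (fun t => f t * g t).
Proof.
move=> [mf [M fM]] [mg [N gN]]; split; first exact: cmeas_mul.
exists (M * N); apply: ae_circ_sub2 fM gN _ => t fM gN.
by rewrite csqM ler_pM// csq_ge0.
Qed.

Lemma Linf_conj f : Linf f -> Linf (fun t => conjc (f t)).
Proof.
move=> [mf [M fM]]; split; first exact: cmeas_conj.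
by exists M; apply: ae_circ_sub fM _ => t; rewrite csqJ.
Qed.

Lemma Linf_opp f : Linf f -> Linf (fun t => - f t).
Proof.
move=> [mf [M fM]]; split; first exact: cmeas_opp.
by exists M; apply: ae_circ_sub fM _ => t; rewrite csqN.
Qed.

Lemma L2_mull f g : Linf f -> L2 g -> L2 (fun t => f t * g t).
Proof.
move=> [mf [M fM]] [mg ig]; split; first exact: cmeas_mul.
apply: (@integrable_le_ae _ (fun t => M * csq (g t))).
- by apply: measurable_csq; exact: cmeas_mul.
- exact: (integrableZl _ M ig).
- apply: ae_circ_sub fM _ => t fM.
  by rewrite ger0_norm ?csq_ge0// csqM ler_wpM2r// csq_ge0.
Qed.

Lemma L2_mulr f g : L2 f -> Linf g -> L2 (fun t => f t * g t).
Proof. by move=> ? ?; under eq_fun do rewrite mulrC; exact: L2_mull. Qed.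

Lemma L2_add f g : L2 f -> L2 g -> L2 (fun t => f t + g t).
Proof.
move=> [mf fi] [mg gi]; split; first exact: cmeas_add.
apply: (@integrable_le_ae _ (fun t => 2 * (csq (f t) + csq (g t)))).
- by apply: measurable_csq; exact: cmeas_add.
- exact: (integrableZl _ 2 (integrableD _ fi gi)).
- by apply: ae_circT => t; rewrite ger0_norm ?csq_ge0// csqD_le.
Qed.

Lemma L2_conj f : L2 f -> L2 (fun t => conjc (f t)).
Proof.
move=> [mf fi]; split; first exact: cmeas_conj.
by under eq_fun do rewrite csqJ.
Qed.

Lemma L2_opp f : L2 f -> L2 (fun t => - f t).
Proof.
move=> [mf fi]; split; first exact: cmeas_opp.
by under eq_fun do rewrite csqN.
Qed.

Lemma Linf_L2 f : Linf f -> L2 f.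
Proof.
move=> [mf [M fM]]; split => //.
apply: (@integrable_le_ae _ (fun t => M)); first exact: measurable_csq.
  exact: integrable_cst_circ.
by apply: ae_circ_sub fM _ => t; rewrite ger0_norm ?csq_ge0.
Qed.

Lemma L2_mul_integ f g : L2 f -> L2 g -> integ (fun t => f t * g t).
Proof.
move=> [mf fi] [mg gi].
have [m1 m2] := cmeas_mul mf mg.
have h : mu.-integrable T (EFin \o (fun t => csq (f t) + csq (g t))).
  exact: (integrableD _ fi gi).
(* Twice what [|xy| <= (x^2 + y^2) / 2] gives; it covers both the real and the imaginary part of a
   product. *)
have key (a b c d : R) : `|a * b + c * d| <= a ^+ 2 + c ^+ 2 + (b ^+ 2 + d ^+ 2).
  rewrite ler_norml; have := sqr_ge0 (a + b); have := sqr_ge0 (c + d).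
  by have := sqr_ge0 (a - b); have := sqr_ge0 (c - d); nra.
split; apply: (integrable_le_ae _ h) => //; apply: ae_circT => t.
  by rewrite creM -mulNr (le_trans (key _ _ _ _))// /csq sqrrN.
by rewrite cimM (le_trans (key _ _ _ _))// /csq [X in _ + X]addrC.
Qed.

Lemma L2_integ f : L2 f -> integ f.
Proof.
move=> f2; have := L2_mul_integ f2 (Linf_L2 (Linf_cst 1)).
by under eq_fun do rewrite mulr1.
Qed.

Lemma L2_cst (c : C) : L2 (fun _ : R => c). Proof. exact: Linf_L2 (Linf_cst c). Qed.

End Spaces.

(** These tactics follow the shape of the function. A product is in L^2 when one factor is bounded
    and the other is in L^2, so [sl2] tries both orders; [sint] also accepts a product of two L^2
    functions. *)
Ltac slinf := lazymatch goal with
  | |- Linf (fun t => (@?f t + @?g t)%R) => apply: (@Linf_add _ f g); slinf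
  | |- Linf (fun t => (@?f t * @?g t)%R) => apply: (@Linf_mul _ f g); slinf
  | |- Linf (fun t => (- (@?f t))%R) => apply: (@Linf_opp _ f); slinf
  | |- Linf (fun t => conjc (@?f t)) => apply: (@Linf_conj _ f); slinf
  | |- _ => solve [assumption | apply: Linf_echar | apply: Linf_cst]
  end.
Ltac sl2 := lazymatch goal with
  | |- L2 (fun t => (@?f t + @?g t)%R) => apply: (@L2_add _ f g); sl2
  | |- L2 (fun t => (@?f t * @?g t)%R) =>
      first [solve [apply: (@L2_mull _ f g); [slinf | sl2]]
            |solve [apply: (@L2_mulr _ f g); [sl2 | slinf]]]
  | |- L2 (fun t => (- (@?f t))%R) => apply: (@L2_opp _ f); sl2
  | |- L2 (fun t => conjc (@?f t)) => apply: (@L2_conj _ f); sl2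
  | |- _ => solve [assumption | apply: L2_cst | apply: Linf_L2; slinf]
  end.
Ltac sint := solve
  [ assumption | apply: integ_conj; sint | apply: integ_add; sint
  | apply: L2_integ; sl2 | apply: L2_mul_integ; sl2 | apply: integ_scale; sint ].

(** * Inner product and norm of L^2 *)

Section InnerProduct.
Local Open Scope classical_set_scope.
Local Open Scope ring_scope.
Context {R : realType}.
Local Notation C := R[i].
Local Notation mu := (@leb R).
Local Notation T := (@circ R).
Implicit Types (f g h : R -> C).

Lemma L2_sum (F : nat -> R -> C) n : (forall k, L2 (F k)) -> L2 (fun t => \sum_(k < n) F k t).
Proof.
move=> LF; elim: n => [|n IH].
  by under eq_fun do rewrite big_ord0; exact: L2_cst.
by under eq_fun do rewrite big_ord_recr /=; exact: L2_add.
Qed.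

Lemma ipDl f g h : L2 f -> L2 g -> L2 h -> ip (fun t => f t + g t) h = ip f h + ip g h.
Proof.
by move=> ? ? ?; rewrite !ipE -meanD; [|sint..]; apply: eq_mean => t; rewrite mulrDl.
Qed.

Lemma ipZl (c : C) f h : L2 f -> L2 h -> ip (fun t => c * f t) h = c * ip f h.
Proof. by move=> ? ?; rewrite !ipE -meanZ; [|sint..]; apply: eq_mean => t; rewrite mulrA. Qed.

Lemma ipC f g : L2 f -> L2 g -> ip f g = conjc (ip g f).
Proof.
move=> ? ?; rewrite !ipE -mean_conj; last sint.
by apply: eq_mean => t; rewrite conjM conjcK mulrC.
Qed.

Lemma ipDr f g h : L2 f -> L2 g -> L2 h -> ip h (fun t => f t + g t) = ip h f + ip h g.
Proof.
by move=> ? ? ?; rewrite !ipE -meanD; [|sint..]; apply: eq_mean => t; rewrite conjD mulrDr.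
Qed.

Lemma ipZr (c : C) f h : L2 f -> L2 h -> ip h (fun t => c * f t) = conjc c * ip h f.
Proof.
move=> ? ?; rewrite !ipE -meanZ; last sint.
by apply: eq_mean => t; rewrite conjM mulrCA.
Qed.

Lemma ip_sumr (F : nat -> R -> C) n h : (forall k, L2 (F k)) -> L2 h ->
  ip h (fun t => \sum_(k < n) F k t) = \sum_(k < n) ip h (F k).
Proof.
move=> LF Lh; elim: n => [|n IH].
  under [X in ip _ X]funext => t do rewrite big_ord0 -(mul0r 0).
  by rewrite big_ord0 ipZr ?rmorph0 ?mul0r//; exact: L2_cst.
under [X in ip _ X]funext => t do rewrite big_ord_recr /=.
by rewrite big_ord_recr /= ipDr ?IH//; exact: L2_sum.
Qed.

Lemma sqnorm_ge0 f : 0 <= sqnorm f.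
Proof.
rewrite mulr_ge0 ?invr_ge0 ?mulr_ge0 ?pi_ge0//.
by apply: Rintegral_ge0 => t _; exact: csq_ge0.
Qed.

Lemma sqnormE f : ip f f = (sqnorm f)%:C%C.
Proof.
rewrite ipE /mean /sqnorm rmorphM; congr (_ * _); apply: complex_ext.
  by apply: eq_Rintegral => t _; rewrite csqE.
rewrite cimR /= -[RHS](Rintegral_set0 mu (fun=> 0)).
transitivity (Rintegral mu T (fun=> 0)); first by apply: eq_Rintegral => t _; rewrite csqE.
by rewrite Rintegral_set0 Rintegral_cst// mul0r.
Qed.

Lemma sqnormZ (c : C) f : L2 f -> sqnorm (fun t => c * f t) = csq c * sqnorm f.
Proof.
move=> [mf fi]; rewrite /sqnorm mulrCA; congr (_ * _).
rewrite -(RintegralZl (csq c) _ fi)//.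
by apply: eq_Rintegral => t _; rewrite csqM.
Qed.

Lemma sqnormN f : sqnorm (fun t => - f t) = sqnorm f.
Proof. by rewrite /sqnorm; congr (_ * _); apply: eq_Rintegral => t _; rewrite csqN. Qed.

Lemma sqnormD f g : L2 f -> L2 g ->
  sqnorm (fun t => f t + g t) = sqnorm f + sqnorm g + 2 * cre (ip f g).
Proof.
move=> ? ?; have fg : L2 (fun t => f t + g t) by sl2.
have := sqnormE (fun t => f t + g t).
rewrite ipDl// !ipDr// [ip g f]ipC// !sqnormE => /(congr1 (@cre R)).
rewrite !creD creJ /= => <-; ring.
Qed.

(** Expand [0 <= ||f - s c g||^2] with [c = <f, g>] and [s] real. Taking [s = 1 / ||g||^2] gives the
    bound; if [||g|| = 0], a large [s] forces [c = 0]. *)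
Lemma cauchy_schwarz f g : L2 f -> L2 g -> csq (ip f g) <= sqnorm f * sqnorm g.
Proof.
move=> Lf Lg; set c := ip f g; set q := csq c; set A := sqnorm f; set B := sqnorm g.
have key (s : R) : 0 <= A + s ^+ 2 * q * B - 2 * s * q.
  have := sqnorm_ge0 (fun t => f t + ((- s)%:C%C * c) * g t).
  rewrite sqnormD//; last by sl2.
  rewrite sqnormZ// ipZr// -/c csqM csq_real -/q -/A -/B conjM conjc_real.
  have -> : (- s)%:C%C * conjc c * c = (- s)%:C%C * q%:C%C by rewrite -csqE; ring.
  by rewrite creM !creR !cimR sqrrN; lra.
have q0 : 0 <= q := csq_ge0 _; have B0 : 0 <= B := sqnorm_ge0 _.
have A0 : 0 <= A := sqnorm_ge0 _.
have [B1|B1] := eqVneq B 0.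
  rewrite B1 mulr0 leNgt; apply/negP => qp.
  (* With [B = 0], this value of [s] turns [key] into [0 <= A - 2 (A + 1)]. *)
  have := key ((A + 1) / q); rewrite B1 mulr0 addr0 -mulrA divfK ?gt_eqF//; lra.
have Bp : 0 < B by rewrite lt_neqAle eq_sym B1.
have := key B^-1; have -> : B^-1 ^+ 2 * q * B = q / B by field.
have -> : 2 * B^-1 * q = 2 * (q / B) by field.
move=> h; have : q / B <= A by lra.
by rewrite ler_pdivrMr.
Qed.

Lemma sqnorm_eq0 f : L2 f -> sqnorm f = 0 -> ae_circ (fun t => f t = 0).
Proof.
move=> [mf fi] /eqP; rewrite mulf_eq0 invr_eq0 mulf_eq0 pnatr_eq0 (gt_eqF (pi_gt0 R)) /= => /eqP i0.
have e0 : (\int[mu]_(t in T) (csq (f t))%:E = 0)%E.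
  by rewrite -[LHS]fineK ?[fine _]i0//; exact: integrable_fin_num.
have m : measurable_fun T (fun t => (csq (f t))%:E).
  by apply/measurable_EFinP; exact: measurable_csq.
have := (@ae_eq_integral_abs _ _ _ mu _ measurable_circ _ m).1.
rewrite -[X in X = _ -> _](_ : (\int[mu]_(t in T) (csq (f t))%:E = _)%E); last first.
  by apply: eq_integral => t _; rewrite gee0_abs// lee_fin csq_ge0.
move=> /(_ e0) /(ae_circE (fun t => _ = _)).2 /ae_circ_sub; apply => t /= [].
exact: csq_eq0.
Qed.

End InnerProduct.

(** * Orthonormality of the characters, and trigonometric polynomials approximating arcs *)

Section Trigonometric.
Local Open Scope classical_set_scope.
Local Open Scope ring_scope.
Context {R : realType}.
Local Notation C := R[i].
Local Notation mu := (@leb R).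
Local Notation T := (@circ R).
Implicit Types (f g h : R -> C).

Lemma sin_period (n : int) : sin (n%:~R * (2 * pi)) = 0 :> R.
Proof.
have natP (m : nat) : sin (m%:R * (2 * pi)) = 0 :> R.
  elim: m => [|m IH]; first by rewrite mul0r sin0.
  by rewrite -natr1 mulrDl mul1r sinD IH mulr_natl sin2pi mul0r mulr0 addr0.
by case: n => m; rewrite ?NegzE ?mulrNz ?mulNr ?sinN pmulrn natP ?oppr0.
Qed.

Lemma cos_period (n : int) : cos (n%:~R * (2 * pi)) = 1 :> R.
Proof.
have natP (m : nat) : cos (m%:R * (2 * pi)) = 1 :> R.
  elim: m => [|m IH]; first by rewrite mul0r cos0.
  by rewrite -natr1 mulrDl mul1r cosD IH [2 * pi]mulr_natl sin2pi cos2pi mulr1 mulr0 subr0.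
by case: n => m; rewrite ?NegzE ?mulrNz ?mulNr ?cosN pmulrn natP.
Qed.

Lemma Rintegral_circ_derive (F F' : R -> R) : (forall x : R, is_derive x (1 : R) F (F' x)) ->
  continuous F' -> F (2 * pi) = F 0 -> Rintegral mu T F' = 0.
Proof.
move=> dF cF' F0.
have cF : continuous F.
  by move=> x; apply: differentiable_continuous; apply/derivable1_diffP; apply: ex_derive.
rewrite /Rintegral /circ (@continuous_FTC2 _ F' F).
- by rewrite F0 -EFinB subrr.
- by rewrite mulr_gt0// pi_gt0.
- exact: continuous_subspaceT.
- split.
  + by move=> x _; apply: ex_derive.
  + by apply: cvg_at_right_filter; exact: cF.
  + by apply: cvg_at_left_filter; exact: cF.
- by move=> x _; rewrite derive1E; exact: derive_val.
Qed.

Lemma mean_cst (c : C) : mean (fun _ : R => c) = c.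
Proof.
have m1 : mean (fun _ : R => 1 : C) = 1.
  have p0 : 2 * pi != 0 :> R by rewrite mulf_neq0// gt_eqF// pi_gt0.
  have mT : mu T = (2 * pi)%:E.
    have := lebesgue_measure_itv `[0%R, (2 * pi : R)%R].
    by rewrite /= lte_fin mulr_gt0 ?pi_gt0// oppr0 adde0.
  apply: complex_ext; rewrite /mean /cint ?creM ?cimM /= !Rintegral_cst//.
    by rewrite mul0r subr0 mul1r [fine _](congr1 fine mT) mulVf.
  by rewrite !mul0r mulr0 addr0.
by have := meanZ c (L2_integ (L2_cst 1)); rewrite m1 mulr1.
Qed.

Lemma mean_echar (n : int) : mean (@echar R n) = (n == 0)%:R.
Proof.
have [->|n0] := eqVneq n 0.
  by rewrite -[RHS]mean_cst; apply: eq_mean => t; rewrite echar0.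
have nR : n%:~R != 0 :> R by rewrite intr_eq0.
have ds (x : R) : is_derive x (1 : R) (fun t => (n%:~R)^-1 * sin (n%:~R * t) : R) (cos (n%:~R * x)).
  by apply: is_derive_eq; rewrite /GRing.scale /=; field.
have dc (x : R) : is_derive x (1 : R) (fun t => - (n%:~R)^-1 * cos (n%:~R * t) : R) (sin (n%:~R * x)).
  by apply: is_derive_eq; rewrite /GRing.scale /=; field.
have cm : continuous (fun t : R => n%:~R * t) by exact: mulrl_continuous.
rewrite /mean /cint (_ : Complex _ _ = 0) ?mulr0//; apply: complex_ext => /=.
  apply: (Rintegral_circ_derive ds).
    by move=> x; apply: continuous_comp; [exact: cm|exact: continuous_cos].
  by rewrite sin_period !mulr0 sin0 mulr0.
apply: (Rintegral_circ_derive dc).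
  by move=> x; apply: continuous_comp; [exact: cm|exact: continuous_sin].
by rewrite cos_period mulr0 cos0.
Qed.

Lemma fcoef_echar (m n : int) : fcoef (@echar R m) n = (m == n)%:R.
Proof.
rewrite /fcoef ipE -subr_eq0 -mean_echar.
by apply: eq_mean => t; rewrite echarD echarN.
Qed.


Definition trig_null f g := forall n, mean (fun t => f t * g t * echar n t) = 0.

(** The bounded multipliers that preserve the vanishing of all Fourier coefficients form an algebra
    containing the characters. Closure under products and sums thus reaches every polynomial in
    [arc_fun] without expanding it into characters. *)
Definition trig_stable f h :=
  Linf h /\ forall g, Linf g -> trig_null f g -> trig_null f (fun t => g t * h t).

Lemma trig_stable_cst f c : L2 f -> trig_stable f (fun=> c).
Proof.
move=> Lf; split=> [|g Lg fg n]; first exact: Linf_cst.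
rewrite -(mulr0 c) -(fg n) -meanZ; last first.
  by apply: L2_integ; have := @Linf_echar R n => ?; sl2.
by apply: eq_mean => t; ring.
Qed.

Lemma trig_stable_echar f m : L2 f -> trig_stable f (echar m).
Proof.
move=> Lf; split=> [|g Lg fg n]; first exact: Linf_echar.
by rewrite -(fg (m + n)); apply: eq_mean => t; rewrite echarD; ring.
Qed.

Lemma trig_stable_mul f h k : trig_stable f h -> trig_stable f k ->
  trig_stable f (fun t => h t * k t).
Proof.
move=> [Lh fh] [Lk fk]; split=> [|g Lg fg n]; first exact: Linf_mul.
rewrite -(fk _ (Linf_mul Lg Lh) (fh _ Lg fg) n).
by apply: eq_mean => t; ring.
Qed.

Lemma trig_stable_add f h k : L2 f -> trig_stable f h -> trig_stable f k ->
  trig_stable f (fun t => h t + k t).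
Proof.
move=> Lf [Lh fh] [Lk fk]; split=> [|g Lg fg n]; first exact: Linf_add.
have Le := @Linf_echar R n.
rewrite -[RHS]addr0 -{1}(fh _ Lg fg n) -(fk _ Lg fg n) -meanD; [|sint..].
by apply: eq_mean => t; ring.
Qed.

Lemma trig_stable_exp f h m : L2 f -> trig_stable f h ->
  trig_stable f (fun t => h t ^+ m).
Proof.
move=> Lf fh; elim: m => [|m IH].
  by under eq_fun do rewrite expr0; exact: trig_stable_cst.
by under eq_fun do rewrite exprS; exact: trig_stable_mul.
Qed.

(* Takes values in [0, 1], and is below 1/2 on ]0, x[ and above on ]x, 2pi[. *)
Definition arc_fun (x t : R) : R := 1 / 2 - sin (t / 2) * sin ((x - t) / 2) / 2.

(* On [0, 1] these polynomials converge boundedly to the indicator of y < 1/2. *)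
Definition step_poly (n : nat) (y : R) : R := (1 - y ^+ n) ^+ (2 ^ n).

(** The half-angles disappear: [sin (t/2) sin ((x-t)/2) = (cos (t - x/2) - cos (x/2)) / 2], so
    [arc_fun x] is a trigonometric polynomial of degree one in [t], with constant term [a] and
    extreme coefficients [b] and [conj b]. *)
Lemma trig_stable_arc f x : L2 f -> trig_stable f (fun t => (arc_fun x t)%:C%C).
Proof.
move=> Lf; pose b : C := (- (1 / 8))%:C%C * Complex (cos (x / 2)) (- sin (x / 2)).
pose a : C := (1 / 2 + cos (x / 2) / 4)%:C%C.
have -> : (fun t => (arc_fun x t)%:C%C) =
    (fun t => a + (b * echar 1 t + conjc b * echar (- 1) t)).
  apply/funext => t; rewrite echarN -conjM /arc_fun.
  apply: complex_ext; last by rewrite !cimD cimJ subrr addr0.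
  rewrite !creD creJ /= mulr1z !mul1r !mul0r !subr0.
  have -> : (x - t) / 2 = x / 2 - t / 2 by ring.
  have e : t = t / 2 + t / 2 by field.
  have ct : cos t = cos (t / 2) * cos (t / 2) - sin (t / 2) * sin (t / 2) by rewrite {1}e cosD.
  have st : sin t = 2 * (sin (t / 2) * cos (t / 2)) by rewrite {1}e sinD; ring.
  rewrite sinB ct st; have := cos2Dsin2 (t / 2).
  move: (cos (t / 2)) (sin (t / 2)) (cos (x / 2)) (sin (x / 2)) => c s C0 S0 h.
  have -> : c * c = 1 - s * s by rewrite -h; ring.
  by field.
apply: trig_stable_add => //; first exact: trig_stable_cst.
by apply: trig_stable_add => //; apply: trig_stable_mul;
  [exact: trig_stable_cst|exact: trig_stable_echar|exact: trig_stable_cst|exact: trig_stable_echar].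
Qed.

Lemma arc_fun_itv x t : 0 <= arc_fun x t <= 1.
Proof.
rewrite /arc_fun; have := cos2Dsin2 (t / 2); have := cos2Dsin2 ((x - t) / 2).
have := sqr_ge0 (cos (t / 2)); have := sqr_ge0 (cos ((x - t) / 2)).
have := sqr_ge0 (sin (t / 2) - sin ((x - t) / 2)).
have := sqr_ge0 (sin (t / 2) + sin ((x - t) / 2)).
move: (sin _) (sin _) (cos _) (cos _) => a b c d; nra.
Qed.

Lemma step_poly_itv n y : 0 <= y <= 1 -> 0 <= step_poly n y <= 1.
Proof.
move=> /andP[y0 y1]; have h : 0 <= 1 - y ^+ n <= 1.
  by rewrite subr_ge0 exprn_ile1//= lerBlDr lerDl exprn_ge0.
by rewrite /step_poly exprn_ge0 ?exprn_ile1//; case/andP: h.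
Qed.

Lemma bernoulli_ge (a : R) m : 0 <= a <= 1 -> 1 - m%:R * a <= (1 - a) ^+ m.
Proof.
move=> /andP[a0 a1]; elim: m => [|m IH]; first by rewrite mul0r subr0 expr0.
rewrite exprS -natr1; have : (0 : R) <= m%:R by [].
by move: (m%:R : R) ((1 - a) ^+ m) IH => k z; nra.
Qed.

(** Combine the Bernoulli inequality [1 + m a <= (1 + a)^m] with [(1 - a) (1 + a) <= 1]. *)
Lemma bernoulli_le (a : R) m : 0 <= a <= 1 -> (1 - a) ^+ m * (m%:R * a) <= 1.
Proof.
move=> /andP[a0 a1].
have h : 1 + m%:R * a <= (1 + a) ^+ m.
  elim: m => [|m IH]; first by rewrite mul0r addr0 expr0.
  rewrite exprS -natr1; have : (0 : R) <= m%:R by [].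
  by move: (m%:R : R) ((1 + a) ^+ m) IH => k z; nra.
have p0 : 0 <= (1 - a) ^+ m by rewrite exprn_ge0// subr_ge0.
apply: (@le_trans _ _ ((1 - a) ^+ m * (1 + a) ^+ m)).
  by rewrite ler_wpM2l//; lra.
by rewrite -exprMn exprn_ile1//; nra.
Qed.

(** With [a = y^n] and exponent [2^n], [bernoulli_ge] squeezes the values between [1 - (2y)^n] and
    1, and [2y < 1]. *)
Lemma step_poly_cvg1 y : 0 <= y < 1 / 2 -> step_poly n y @[n --> \oo] --> (1 : R).
Proof.
move=> /andP[y0 y1].
apply: (@squeeze_cvgr _ _ _ _ (fun n => 1 - (2 * y) ^+ n) (fun=> 1)).
- apply: nearW => n; have y11 : y <= 1 by lra.
  have /(step_poly_itv n)/andP[_ ->] : 0 <= y <= 1 by rewrite y0.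
  rewrite andbT exprMn -natrX.
  by apply: bernoulli_ge; rewrite exprn_ge0//= exprn_ile1.
- have e : (2 * y) ^+ n @[n --> \oo] --> (0 : R) by apply: cvg_expr; rewrite ger0_norm; lra.
  by have := cvgB (cvg_cst (1 : R)) e; rewrite subr0; apply.
- exact: cvg_cst.
Qed.

(** With the same [a] and exponent, [bernoulli_le] bounds the values by [(2y)^-n], and now
    [2y > 1]. *)
Lemma step_poly_cvg0 y : 1 / 2 < y <= 1 -> step_poly n y @[n --> \oo] --> (0 : R).
Proof.
move=> /andP[y0 y1]; have yp : 0 < y by lra.
apply: (@squeeze_cvgr _ _ _ _ (fun=> 0) (fun n => ((2 * y)^-1) ^+ n)).
- apply: nearW => n.
  have /(step_poly_itv n)/andP[-> _] : 0 <= y <= 1 by rewrite y1 ltW.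
  rewrite /=.
  rewrite exprVn -[leRHS]mul1r ler_pdivlMr ?exprn_gt0 ?mulr_gt0//.
  rewrite exprMn -natrX; apply: bernoulli_le.
  by rewrite exprn_ge0 ?(ltW yp)//= exprn_ile1// (ltW yp).
- exact: cvg_cst.
- apply: cvg_expr; rewrite ger0_norm ?invr_ge0; last by lra.
  by rewrite invf_lt1; lra.
Qed.

(** Both [t / 2] and [(x - t) / 2] lie in ]0, pi[, so the product of sines is positive; on the other
    side of [x] the second sine changes sign. *)
Lemma arc_fun_lt x t : 0 < x < 2 * pi -> 0 < t < 2 * pi -> t < x -> arc_fun x t < 1 / 2.
Proof.
move=> /andP[x0 x1] /andP[t0 t1] tx; rewrite /arc_fun.
have : 0 < sin (t / 2) by apply: sin_gt0_pi; lra.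
have : 0 < sin ((x - t) / 2) by apply: sin_gt0_pi; lra.
by move: (sin _) (sin _) => a b; nra.
Qed.

Lemma arc_fun_gt x t : 0 < x < 2 * pi -> 0 < t < 2 * pi -> x < t -> 1 / 2 < arc_fun x t.
Proof.
move=> /andP[x0 x1] /andP[t0 t1] tx; rewrite /arc_fun.
have : 0 < sin (t / 2) by apply: sin_gt0_pi; lra.
have -> : (x - t) / 2 = - ((t - x) / 2) by field.
have : 0 < sin ((t - x) / 2) by apply: sin_gt0_pi; lra.
by rewrite sinN; move: (sin _) (sin _) => a b; nra.
Qed.

Lemma measurable_step_arc n x : measurable_fun T (fun t => step_poly n (arc_fun x t)).
Proof.
have ms : measurable_fun setT (@sin R).
  by apply: continuous_measurable_fun; exact: continuous_sin.
have mh (v : R -> R) : measurable_fun T v -> measurable_fun T (fun t => sin (v t / 2)).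
  move=> mv; apply: (measurableT_comp ms).
  by apply: measurable_funM => //; exact: measurable_cst.
have m1 : measurable_fun T (fun t : R => sin (t / 2)) by apply: mh; exact: measurable_id.
have m2 : measurable_fun T (fun t : R => sin ((x - t) / 2)).
  by apply: mh; apply: measurable_funB; [exact: measurable_cst|exact: measurable_id].
apply: measurable_funX; apply: measurable_funB; first exact: measurable_cst.
apply: measurable_funX; apply: measurable_funB; first exact: measurable_cst.
by apply: measurable_funM; [exact: measurable_funM|exact: measurable_cst].
Qed.

End Trigonometric.

(** * Uniqueness of Fourier coefficients *)

Section Uniqueness.
Local Open Scope classical_set_scope.
Local Open Scope ring_scope.
Context {R : realType}.
Local Notation C := R[i].
Local Notation mu := (@leb R).
Local Notation T := (@circ R).
Implicit Types (f : R -> C) (u : R -> R).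

Lemma ae_circ_neq (x : R) : ae_circ (fun t => t <> x).
Proof.
have n : mu.-negligible [set x].
  by apply/negligibleP; [exact: measurable_set1|exact: lebesgue_measure_set1].
by apply: negligibleS n => t [_ /=] /contrapT.
Qed.

(** Dominated convergence with bound [|u|]: the polynomial factors stay in [0, 1] and tend almost
    everywhere on the circle to the indicator of ]-oo, x]. *)
Lemma step_limit u x : mu.-integrable T (EFin \o u) -> 0 < x < 2 * pi ->
  (forall n, Rintegral mu T (fun t => u t * step_poly n (arc_fun x t)) = 0) ->
  Rintegral mu T (u \_ `]-oo, x]%classic) = 0.
Proof.
move=> iu x02 step0.
have mu_ : measurable_fun T u by case/integrableP: iu => /measurable_EFinP.
have mf n : measurable_fun T (fun t => u t * step_poly n (arc_fun x t)).
  by apply: measurable_funM => //; exact: measurable_step_arc.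
have f_le n t : `|u t * step_poly n (arc_fun x t)| <= `|u t|.
  have /andP[s0 s1] := step_poly_itv n (arc_fun_itv x t).
  by rewrite normrM (ger0_norm s0) ler_piMr.
have mlim : measurable_fun T (u \_ `]-oo, x]%classic).
  apply/measurable_restrict => //.
  by apply: measurable_funS mu_ => // t [].
have mfe n : measurable_fun T (EFin \o (fun t => u t * step_poly n (arc_fun x t))).
  exact/measurable_EFinP.
have mlime : measurable_fun T (EFin \o (u \_ `]-oo, x]%classic)).
  exact/measurable_EFinP.
pose f_ (n : nat) (t : R) := (u t * step_poly n (arc_fun x t))%:E.
have [] := @dominated_convergence _ _ _ mu T (@measurable_circ R) f_
   (EFin \o (u \_ `]-oo, x]%classic)) (fun t => `|u t|%:E).
- exact: mfe.
- exact: mlime.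
- apply/(ae_circE (fun t => f_ ^~ t @ \oo --> _)).1.
  (* At 0, [x] and [2 pi] the value of [arc_fun x] is exactly 1/2, where the polynomials tend to
     neither 0 nor 1; these three points are discarded as a null set. *)
  apply: (@ae_circ_sub _ (fun t => t \in `[0, 2 * pi] /\ (t <> 0 /\ (t <> x /\ t <> 2 * pi)))).
    apply: ae_circ_and; first by apply: negligibleS (negligible_set0 _) => t [].
    by do 2 (apply: ae_circ_and; first exact: ae_circ_neq); exact: ae_circ_neq.
  move=> t []; rewrite in_itv /= => /andP[t0 t1] [/eqP n0 [/eqP nx /eqP n1]].
  have t02 : 0 < t < 2 * pi by rewrite !lt_neqAle t0 t1 eq_sym n0 n1.
  apply: cvg_EFin; first exact: nearW.
  rewrite /f_ patchE; case: ifPn; rewrite ?notin_setE ?in_setE /= in_itv /=.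
    move=> tx; rewrite -[X in _ --> X]mulr1; apply: cvgM; first exact: cvg_cst.
    apply: step_poly_cvg1; rewrite (andP (arc_fun_itv _ _)).1/=.
    by apply: arc_fun_lt; rewrite // lt_neqAle nx.
  move=> /negP; rewrite -ltNge => tx; rewrite -[X in _ --> X](mulr0 (u t)).
  apply: cvgM; first exact: cvg_cst.
  apply: step_poly_cvg0; rewrite (andP (arc_fun_itv _ _)).2 andbT.
  by apply: arc_fun_gt.
- exact: integrable_norm.
- by apply: aeW => t n _; rewrite lee_fin.
move=> il _; rewrite [X in X @ _ --> _](_ : _ = cst 0%E); last first.
  apply/funext => n /=; rewrite -[LHS]fineK; last first.
    apply: integrable_fin_num => //.
    apply: (le_integrable _ _ _ iu) => //; first exact: mfe.
    by move=> t _ /=; rewrite lee_fin.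
  by congr (_%:E); exact: step0.
move=> lim; have h := cvg_unique _ (cvg_cst (0%E : \bar R)) lim.
by rewrite /Rintegral -h.
Qed.

(** By [step_limit] the primitive of [u], extended by 0 off the circle, vanishes on ]0, 2pi[; by
    Lebesgue differentiation its derivative is [u] almost everywhere. *)
Lemma ae_eq0_of_step u : mu.-integrable T (EFin \o u) ->
  (forall x n, Rintegral mu T (fun t => u t * step_poly n (arc_fun x t)) = 0) ->
  ae_circ (fun t => u t = 0).
Proof.
move=> iu step0.
have iU : mu.-integrable setT (EFin \o (u \_ T)).
  by rewrite -restrict_EFin; apply/(integrable_mkcond _ _).1.
have iUy (y : R) : mu.-integrable `]-oo, y] (EFin \o (u \_ T)).
  by apply: integrableS iU.
have locU : locally_integrable setT (u \_ T).
  by apply: integrable_locally.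
have := FTC1Ny iUy locU.
move=> [N [mN N0 sub]].
have aeN : ae_circ (fun t => ~ N t).
  have n : mu.-negligible N by apply/negligibleP.
  by apply: negligibleS n => t [_ /=] /contrapT.
have aet : ae_circ (fun t : R => t \in `[0, 2 * pi] /\ (t <> 0 /\ t <> 2 * pi)).
  apply: ae_circ_and; first by apply: negligibleS (negligible_set0 _) => t [].
  by apply: ae_circ_and; exact: ae_circ_neq.
apply: ae_circ_sub2 aeN aet _ => t Nt [] tT [/eqP n0 /eqP n1].
move: (tT); rewrite in_itv /= => /andP[t0 t1].
have t02 : 0 < t < 2 * pi by rewrite !lt_neqAle t0 t1 eq_sym n0 n1.
pose G (y : R) := Rintegral mu [set` `]-oo, y]] (u \_ T).
have /contrapT [_] : ~ ~ (derivable G t 1 /\ G^`()%classic t = (u \_ T) t).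
  by move=> h; apply: Nt; apply: sub.
rewrite patchE mem_set// => <-.
have [t0' t1'] := andP t02.
rewrite derive1E (near_eq_derive (g := cst 0)) ?derive_cst//.
(* The derivative at [t] only sees points [y] close to [t], hence inside ]0, 2pi[, where
   [step_limit] applies. *)
near=> y; rewrite /G -Rintegral_mkcondr setIC Rintegral_mkcondr.
apply: step_limit => //; suff : y \in `]0, 2 * pi[ by rewrite in_itv.
by near: y; apply: near_in_itvoo; rewrite in_itv.
Unshelve. all: by end_near.
Qed.

(** Starting from the constant 1, stability yields a zero integral of [f] against every
    [step_poly n (arc_fun x t)]. These factors are real, so the integrals split into those of the
    real and imaginary parts of [f], and each part is treated by [ae_eq0_of_step]. *)
Lemma fourier_unique f : L2 f -> (forall n, fcoef f n = 0) -> ae_circ (fun t => f t = 0).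
Proof.
move=> Lf f0; have [if1 if2] := L2_integ Lf.
have null1 : trig_null f (fun=> 1).
  move=> n; rewrite -(f0 (- n)) /fcoef ipE.
  by apply: eq_mean => t; rewrite mulr1 echarN conjcK.
have step (x : R) n : integ (fun t => f t * (step_poly n (arc_fun x t))%:C%C) /\
    mean (fun t => f t * (step_poly n (arc_fun x t))%:C%C) = 0.
  have st : trig_stable f (fun t => (step_poly n (arc_fun x t))%:C%C).
    have -> : (fun t => (step_poly n (arc_fun x t))%:C%C) =
      (fun t => (1 + (-1) * (arc_fun x t)%:C%C ^+ n) ^+ (2 ^ n)).
      apply/funext => t.
      by rewrite /step_poly rmorphXn rmorphB rmorph1 rmorphXn /= mulN1r.
    apply: trig_stable_exp => //; apply: trig_stable_add => //.
      exact: trig_stable_cst.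
    apply: trig_stable_mul; first exact: trig_stable_cst.
    by apply: trig_stable_exp => //; exact: trig_stable_arc.
  have [L1 h1] := st; split; first by sint.
  rewrite -(h1 _ (Linf_cst 1) null1 0); apply: eq_mean => t.
  by rewrite echar0 mul1r mulr1.
have Rint0 (g : R -> C) : mean g = 0 ->
    Rintegral mu T (fun t => cre (g t)) = 0 /\ Rintegral mu T (fun t => cim (g t)) = 0.
  move=> /eqP; rewrite mulf_eq0 => /orP[/eqP/(congr1 (@cre R))/eqP|/eqP[-> ->]//].
  by rewrite creR /= invr_eq0 mulf_eq0 pnatr_eq0 (gt_eqF (pi_gt0 R)).
have re0 : ae_circ (fun t => cre (f t) = 0).
  apply: ae_eq0_of_step => // x n; rewrite -(Rint0 _ (step x n).2).1.
  by apply: eq_Rintegral => t _; rewrite creM creR cimR mulr0 subr0.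
have im0 : ae_circ (fun t => cim (f t) = 0).
  apply: ae_eq0_of_step => // x n; rewrite -(Rint0 _ (step x n).2).2.
  by apply: eq_Rintegral => t _; rewrite cimM creR cimR mulr0 add0r.
by apply: ae_circ_sub2 re0 im0 _ => t a b; apply: complex_ext.
Qed.


End Uniqueness.

(** * Completeness of L^2 *)

Section Completeness.
Local Open Scope classical_set_scope.
Local Open Scope ring_scope.
Context {R : realType}.
Local Notation C := R[i].
Local Notation mu := (@leb R).
Local Notation T := (@circ R).
Implicit Types (f : R -> C).

Let pi2_gt0 : 0 < 2 * pi :> R. Proof. by rewrite mulr_gt0// pi_gt0. Qed.

Lemma integral_csq f : L2 f -> (\int[mu]_(t in T) (csq (f t))%:E = (2 * pi * sqnorm f)%:E)%E.
Proof.
move=> [mf fi]; rewrite -[LHS]fineK; last exact: integrable_fin_num.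
by congr (_%:E); rewrite /sqnorm mulrA mulfV ?mul1r ?gt_eqF.
Qed.

Lemma L2_of_integral_le f c : cmeas f -> (\int[mu]_(t in T) (csq (f t))%:E <= (2 * pi * c)%:E)%E ->
  L2 f /\ sqnorm f <= c.
Proof.
move=> mf fc; have Lf : L2 f.
  split => //; apply/integrableP; split; first by apply/measurable_EFinP; exact: measurable_csq.
  apply: le_lt_trans (ltry (2 * pi * c)); apply: le_trans fc.
  under eq_integral do rewrite gee0_abs ?lee_fin ?csq_ge0//.
  by [].
split => //; move: fc; rewrite integral_csq// lee_fin.
by rewrite ler_pM2l.
Qed.

(** The increments form an absolutely convergent telescoping series. *)
Lemma cvg_of_bounded_variation (a : nat -> R) (B : R) :
  (forall n, \sum_(0 <= k < n) `|a k.+1 - a k| <= B) -> cvgn a.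
Proof.
move=> aB; have c1 : cvgn (series (telescope a)).
  apply: normed_cvg; apply: nondecreasing_is_cvgn.
    apply/nondecreasing_seqP => n.
    by rewrite /= seriesSr lerDl.
  by exists B => _ [n _ <-]; exact: aB.
rewrite (_ : a = (fun n => a 0%N + series (telescope a) n)); last first.
  by apply/funext => n; rewrite -eq_sum_telescope.
by apply: is_cvgD => //; exact: is_cvg_cst.
Qed.

Lemma sum_half (n : nat) : \sum_(0 <= k < n) (2^-1 : R) ^+ k <= 2.
Proof.
have h1 : `|2^-1 : R| < 1 by rewrite ger0_norm ?invr_ge0// invf_lt1// ltr1n.
have := @geometric_le_lim R n 1 2^-1 ler01 _ h1; rewrite invr_gt0 ltr0n => /(_ isT).
rewrite /series /= /geometric /=; under eq_bigr do rewrite mul1r.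
by move=> /le_trans; apply; rewrite (_ : 1 - 2^-1 = 2^-1 :> R) ?invrK; lra.
Qed.

(* The weights turn the finiteness of the sum of squares into that of the variation,
   by [|x| <= p + x^2 / p] with p = 2^-k. *)
Lemma cvg_of_weighted_squares (a : nat -> R) (d : nat -> R) (M : R) :
  (forall k, (a k.+1 - a k) ^+ 2 <= d k) ->
  (forall n, \sum_(0 <= k < n) 2 ^+ k * d k <= M) -> cvgn a.
Proof.
move=> ad dM; apply: (@cvg_of_bounded_variation _ (2 + M)) => n.
apply: le_trans (lerD (sum_half n) (dM n)); rewrite -big_split /=.
apply: ler_sum => k _; have := ad k; move: (a k.+1 - a k) => x xd.
have q0 : (0 : R) < 2 ^+ k by rewrite exprn_gt0.
have : 2 ^+ k * x ^+ 2 <= 2 ^+ k * d k by rewrite ler_pM2l.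
rewrite exprVn; move: (2 ^+ k) q0 (2 ^+ k * d k) => q q0 e xe.
rewrite -(ler_pM2l q0) mulrDr mulfV ?gt_eqF//.
rewrite -(ler_pM2l q0) in xe.
have e1 : (q * `|x|) ^+ 2 <= q * e by rewrite exprMn real_normK ?num_real// expr2 -mulrA.
have := sqr_ge0 (q * `|x| - 1); nra.
Qed.

(** The rate [4^-k] is chosen so that the weights [2^k] of [cvg_of_weighted_squares] still leave the
    summable bound [2^-k]. *)
Lemma fast_subsequence (s : nat -> R -> C) :
  (forall e, 0 < e -> exists N, forall n m, (N <= n)%N -> (N <= m)%N ->
    sqnorm (fun t => s n t - s m t) <= e) ->
  exists r : nat -> nat, forall k n m, (r k <= n)%N -> (r k <= m)%N ->
    sqnorm (fun t => s n t - s m t) <= 4^-1 ^+ k /\ (k <= r k <= r k.+1)%N.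
Proof.
move=> sC; have p4 k : (0 : R) < 4^-1 ^+ k by rewrite exprn_gt0// invr_gt0.
have [N NP] := choice (fun k => sC _ (p4 k)).
(* Summing all the thresholds up to [k] makes the index monotone and at least [N k]; the summand [k]
   makes it tend to infinity. *)
exists (fun k => k + \sum_(i < k.+1) N i)%N => k n m kn km; split; last first.
  by rewrite leq_addr [X in (_ <= _ + X)%N]big_ord_recr leq_add// leq_addr.
have Nr : (N k <= k + \sum_(i < k.+1) N i)%N by rewrite big_ord_recr addnA leq_addl.
by apply: NP; [exact: leq_trans kn|exact: leq_trans km].
Qed.

(** The series of the [2^k |t_(k+1) - t_k|^2] has integral at most [2 pi * 2], so its sum is finite
    almost everywhere; where it is finite, [cvg_of_weighted_squares] applies to each component. *)
Lemma cvg_subsequence_ae (t_ : nat -> R -> C) : (forall n, L2 (t_ n)) ->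
  (forall k, sqnorm (fun t => t_ k.+1 t - t_ k t) <= 4^-1 ^+ k) ->
  ae_circ (fun t => cvgn (fun k => cre (t_ k t)) /\ cvgn (fun k => cim (t_ k t))).
Proof.
move=> Lt tk; pose d k t := csq (t_ k.+1 t - t_ k t).
have Ld k : L2 (fun t => t_ k.+1 t - t_ k t) by have := Lt k; have := Lt k.+1 => ? ?; sl2.
pose w k t := (2 ^+ k * d k t)%:E.
have w0 k t : (0 <= w k t)%E by rewrite lee_fin mulr_ge0 ?csq_ge0// exprn_ge0.
have mw k : measurable_fun T (w k).
  apply/measurable_EFinP; apply: measurable_funM; first exact: measurable_cst.
  by apply: measurable_csq; case: (Ld k).
have iw k : (\int[mu]_(t in T) w k t <= (2 * pi * 2^-1 ^+ k)%:E)%E.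
  rewrite /w; under eq_integral do rewrite EFinM.
  rewrite ge0_integralZl//; last 2 first.
  - by apply/measurable_EFinP; apply: measurable_csq; case: (Ld k).
  - by move=> t _; rewrite lee_fin csq_ge0.
  rewrite integral_csq// -EFinM lee_fin mulrCA ler_pM2l//.
  apply: le_trans (ler_wpM2l _ (tk k)) _; first exact: exprn_ge0.
  by rewrite -exprMn (_ : 2 * 4^-1 = 2^-1 :> R)//; lra.
have iW : mu.-integrable T (fun t => \sum_(0 <= k <oo) w k t)%E.
  apply/integrableP; split.
    by apply: ge0_emeasurable_sum => [k t _ _|k _]; [exact: w0|exact: mw].
  apply: (@le_lt_trans _ _ (2 * pi * 2)%:E); last exact: ltry.
  have e : (\int[mu]_(t in T) `|\sum_(0 <= k <oo) w k t| =
      \int[mu]_(t in T) \sum_(0 <= k <oo) w k t)%E.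
    apply: eq_integral => t _; rewrite gee0_abs//.
    by apply: nneseries_ge0 => k _ _; exact: w0.
  rewrite [X in (X <= _)%E]e.
  rewrite integral_nneseries//.
  apply: lime_le.
    by apply: is_cvg_nneseries => n _ _; exact: integral_ge0.
  apply: nearW => n; apply: (@le_trans _ _ (\sum_(0 <= k < n) (2 * pi * 2^-1 ^+ k)%:E)%E).
    by apply: lee_sum => k _; exact: iw.
  by rewrite sumEFin lee_fin -mulr_sumr ler_pM2l// sum_half.
have := (ae_circE (fun t => _ \is a fin_num)).2 (@integrable_ae _ _ _ mu T (@measurable_circ R) _ iW).
move=> /ae_circ_sub; apply => t /= fint.
have dM n : \sum_(0 <= k < n) 2 ^+ k * d k t <= fine (\sum_(0 <= k <oo) w k t)%E.
  rewrite -lee_fin fineK// -sumEFin.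
  exact: (@nneseries_lim_ge _ (fun k => w k t)).
split; apply: (cvg_of_weighted_squares (d := fun k => d k t) _ dM) => k.
  by rewrite /d /csq creD creN lerDl sqr_ge0.
by rewrite /d /csq cimD cimN lerDr sqr_ge0.
Qed.

(** The almost everywhere limit of a fast subsequence is the L^2 limit of the whole sequence: by the
    lemma of Fatou, a bound on [||t_ j - s n||^2] valid for all large [j] passes to
    [||f - s n||^2]. *)
Lemma L2_complete (s : nat -> R -> C) : (forall n, L2 (s n)) ->
  (forall e, 0 < e -> exists N, forall n m, (N <= n)%N -> (N <= m)%N ->
    sqnorm (fun t => s n t - s m t) <= e) ->
  exists f, L2 f /\ forall e, 0 < e -> exists N, forall n, (N <= n)%N ->
    sqnorm (fun t => f t - s n t) <= e.
Proof.
move=> Ls sC; have [r rP] := fast_subsequence sC.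
have rS k : (k <= r k <= r k.+1)%N by case: (rP k (r k) (r k)).
pose t_ k := s (r k).
have [N [mN N0 sub]] : ae_circ (fun t => cvgn (fun k => cre (t_ k t)) /\ cvgn (fun k => cim (t_ k t))).
  apply: cvg_subsequence_ae => [n|k]; first exact: Ls.
  by have /andP[_ rk] := rS k; case: (rP k (r k.+1) (r k)).
(* Both components are set to 0 on the null set [N], so that they converge at every point of the
   circle and the limit is measurable. *)
pose a (k : nat) : R -> R := (fun t : R => cre (t_ k t)) \_ (~` N).
pose b (k : nat) : R -> R := (fun t : R => cim (t_ k t)) \_ (~` N).
have cpatch (v : nat -> R -> R) t : (~ N t -> cvgn (fun k => v k t)) ->
    cvgn (fun k => (v k \_ (~` N)) t).
  move=> vt; have [Nt|Nt] := pselect (N t).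
    rewrite (_ : (fun k => _) = (fun=> 0)); first exact: is_cvg_cst.
    by apply/funext => k; rewrite patchE memNset.
  rewrite (_ : (fun k => _) = (fun k => v k t)); first exact: vt.
  by apply/funext => k; rewrite patchE mem_set.
have subN t : T t -> ~ N t ->
    cvgn (fun k => cre (t_ k t)) /\ cvgn (fun k => cim (t_ k t)).
  by move=> Tt Nt; apply: contrapT => h; apply: Nt; apply: sub.
have cab t : T t -> cvgn (a ^~ t) /\ cvgn (b ^~ t).
  by move=> Tt; split; apply: cpatch => /(subN t Tt) [].
have mab k : measurable_fun T (a k) /\ measurable_fun T (b k).
  have [[m1 m2] _] := Ls (r k).
  by split; (apply/measurable_restrict => //; [exact: measurableC|];
    apply: measurable_funS; [| |eassumption] => // t []).
pose f (t : R) : C := Complex (limn (a ^~ t)) (limn (b ^~ t)).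
have mf : cmeas f.
  split; apply: (measurable_fun_cvg (h := _)); [exact: (fun k => (mab k).1)| |
    exact: (fun k => (mab k).2)|] => t Tt; [exact: (cab t Tt).1|exact: (cab t Tt).2].
have key e k n : 0 < e -> (forall j, (k <= j)%N -> sqnorm (fun t => t_ j t - s n t) <= e) ->
    L2 (fun t => f t - s n t) /\ sqnorm (fun t => f t - s n t) <= e.
  move=> e0 He.
  have ms := (Ls n).1.
  have mfs : cmeas (fun t => f t - s n t) by apply: cmeas_add => //; exact: cmeas_opp.
  apply: L2_of_integral_le => //.
  (* The shift by [k] keeps all indices in the range where the bound [He] holds. *)
  pose g (j : nat) (t : R) := (csq (Complex (a (j + k)%N t) (b (j + k)%N t) - s n t))%:E.
  have mg j : cmeas (fun t => Complex (a (j + k)%N t) (b (j + k)%N t) - s n t).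
    by apply: cmeas_add; [exact: mab|exact: cmeas_opp].
  have mge j : measurable_fun T (g j) by apply/measurable_EFinP; exact: measurable_csq.
  have glim t : T t -> (csq (f t - s n t))%:E = limn_einf (g ^~ t).
    move=> Tt; suff /cvg_limn_einf_sup[-> _] : g ^~ t @ \oo --> (csq (f t - s n t))%:E by [].
    apply: cvg_EFin; first exact: nearW.
    have [/cvg_ex [la ca] /cvg_ex [lb cb]] := cab t Tt.
    have ca' : a (j + k)%N t @[j --> \oo] --> la by rewrite (cvg_shiftn k (a ^~ t)).
    have cb' : b (j + k)%N t @[j --> \oo] --> lb by rewrite (cvg_shiftn k (b ^~ t)).
    rewrite /csq /f !creD !creN !cimD !cimN /= (cvg_lim _ ca)// (cvg_lim _ cb)//.
    under eq_fun do rewrite /g /csq /= !creD !creN !cimD !cimN /=.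
    by apply: cvgD; apply: cvgM; apply: cvgB => //; exact: cvg_cst.
  have eg : (\int[mu]_(t in T) (csq (f t - s n t))%:E = \int[mu]_(t in T) limn_einf (g ^~ t))%E.
    by apply: eq_integral => t; rewrite inE => Tt; exact: glim.
  rewrite [X in (X <= _)%E]eg.
  apply: le_trans (fatou _ _ _ _) _ => //.
    by move=> j t _; rewrite lee_fin csq_ge0.
  rewrite limn_einf_lim; apply: lime_le; first exact: is_cvg_einfs.
  apply: nearW => j; apply: (@le_trans _ _ (\int[mu]_(t in T) g j t)%E).
    by apply: ereal_inf_lbound; exists j => /=.
  have Lts : L2 (fun t => t_ (j + k)%N t - s n t).
    by have := Ls n; have : L2 (t_ (j + k)%N) := Ls _ => ? ?; sl2.
  apply: (@le_trans _ _ (\int[mu]_(t in T) (csq (t_ (j + k)%N t - s n t))%:E)%E); last first.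
    by rewrite integral_csq// lee_fin ler_pM2l// He// leq_addl.
  have n1 t : T t -> (0 <= g j t)%E by move=> _; rewrite lee_fin csq_ge0.
  have n2 t : T t -> (0 <= (csq (t_ (j + k)%N t - s n t))%:E)%E.
    by move=> _; rewrite lee_fin csq_ge0.
  have m2 : measurable_fun T (fun t => (csq (t_ (j + k)%N t - s n t))%:E).
    by apply/measurable_EFinP; apply: measurable_csq; case: Lts.
  have aeg : ae_circ (fun t : R => (g j t <= (csq (t_ (j + k)%N t - s n t))%:E)%E).
    apply: (@ae_circ_sub _ (fun t => ~ N t)).
      have nN : mu.-negligible N by apply/negligibleP.
      by apply: negligibleS nN => t [_ /=] /contrapT.
    move=> t Nt; rewrite lee_fin /a /b !patchE !mem_set//.
    by case: (t_ _ _).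
  have aeg' := (ae_circE _).1 aeg.
  by apply: ae_ge0_le_integral; solve [done | exact: mge | exact: m2 | exact: aeg'].
have key2 e : 0 < e -> exists M, forall n, (M <= n)%N ->
    L2 (fun t => f t - s n t) /\ sqnorm (fun t => f t - s n t) <= e.
  move=> e0; have [M MP] := sC e e0; exists M => n Mn.
  (* The Cauchy rank [M] also serves for the subsequence, because [j <= r j]. *)
  apply: (key e M) => // j Mj; apply: MP => //; apply: leq_trans Mj _.
  by case/andP: (rS j).
exists f; split; last by move=> e /key2[M MP]; exists M => n /MP [].
(* Square-integrability of [f] itself comes from [f = (f - s M) + s M]. *)
have [M /(_ _ (leqnn M))[Lfs _]] := key2 1 ltr01.
have := Ls M => LM.
have : L2 (fun t => (f t - s M t) + s M t) by apply: L2_add.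
by under eq_fun do rewrite subrK.
Qed.

End Completeness.

(** * Fourier partial sums, the Riesz projection and products in H^2 *)

Section HardySpace.
Local Open Scope classical_set_scope.
Local Open Scope ring_scope.
Context {R : realType}.
Local Notation C := R[i].
Implicit Types (f g h F : R -> C).

Lemma L2_echar n : L2 (@echar R n). Proof. exact: Linf_L2 (Linf_echar n). Qed.

Lemma csq_le_eq0 (z : C) (B : R) : (forall e, 0 < e -> csq z <= e * B) -> z = 0.
Proof.
move=> zB; apply: csq_eq0; apply/eqP; rewrite eq_le csq_ge0 andbT leNgt.
apply/negP => z0; have B0 : 0 < B.
  by have := lt_le_trans z0 (zB 1 ltr01); rewrite mul1r.
have e0 : 0 < csq z / (2 * B) by rewrite divr_gt0// mulr_gt0.
have := zB _ e0; have -> : csq z / (2 * B) * B = csq z / 2 by field; rewrite gt_eqF.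
lra.
Qed.

Lemma eq_fcoef f g n : f =1 g -> fcoef f n = fcoef g n.
Proof. by move=> /funext ->. Qed.

Lemma eq_ip f g h k : f =1 h -> g =1 k -> ip f g = ip h k.
Proof. by move=> /funext -> /funext ->. Qed.

Lemma fcoefD f g n : L2 f -> L2 g -> fcoef (fun t => f t + g t) n = fcoef f n + fcoef g n.
Proof. by move=> ? ?; apply: ipDl => //; exact: L2_echar. Qed.

Lemma fcoefZ (c : C) f n : L2 f -> fcoef (fun t => c * f t) n = c * fcoef f n.
Proof. by move=> ?; apply: ipZl => //; exact: L2_echar. Qed.

Lemma fcoefN f n : L2 f -> fcoef (fun t => - f t) n = - fcoef f n.
Proof.
by move=> ?; rewrite -mulN1r -fcoefZ//; apply: eq_fcoef => t; rewrite mulN1r.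
Qed.

Lemma fcoef_shift f m n : fcoef (fun t => echar m t * f t) n = fcoef f (n - m).
Proof.
rewrite /fcoef !ipE; apply: eq_mean => t; rewrite echarD echarN conjM conjcK; ring.
Qed.

Lemma fcoefJ f n : L2 f -> fcoef (fun t => conjc (f t)) n = conjc (fcoef f (- n)).
Proof.
move=> Lf; have Ln := L2_echar (- n).
rewrite /fcoef !ipE -mean_conj; last by sint.
by apply: eq_mean => t; rewrite echarN conjcK conjM.
Qed.

Lemma fcoef_ae f g n : L2 f -> L2 g -> ae_circ (fun t => f t = g t) -> fcoef f n = fcoef g n.
Proof.
move=> Lf Lg fg; have Ln := L2_echar n; apply: mean_ae; first by sint.
  by apply: integ_meas; sint.
by apply: ae_circ_sub fg _ => t ->.
Qed.

Lemma sqnorm_ae f g : L2 f -> L2 g -> ae_circ (fun t => f t = g t) -> sqnorm f = sqnorm g.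
Proof.
move=> [mf fi] [mg gi] fg; rewrite /sqnorm; congr (_ * _).
apply: (integrable_ae_eq fi (measurable_csq mg) _).2.
by apply: ae_circ_sub fg _ => t ->.
Qed.

Lemma sqnorm_echar n : sqnorm (@echar R n) = 1.
Proof.
have := @fcoef_echar R n n; rewrite /fcoef sqnormE eqxx => /(congr1 (@cre R)).
by rewrite creR.
Qed.

Lemma fcoef_le f n : L2 f -> csq (fcoef f n) <= sqnorm f.
Proof.
move=> Lf; have := cauchy_schwarz Lf (L2_echar n).
by rewrite sqnorm_echar mulr1.
Qed.

(** Only nonnegative frequencies occur: these sums approximate the projection of [F] onto H^2, not
    [F] itself. *)
Definition partial_sum F (N : nat) (t : R) : C :=
  \sum_(k < N) fcoef F k%:Z * echar k%:Z t.

Lemma partial_sumS F N :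
  partial_sum F N.+1 = (fun t => partial_sum F N t + fcoef F N%:Z * echar N%:Z t).
Proof. by apply/funext => t; rewrite /partial_sum big_ord_recr. Qed.

Lemma L2_partial_sum F N : L2 (partial_sum F N).
Proof.
apply: (@L2_sum _ (fun k t => fcoef F k%:Z * echar k%:Z t)) => k.
by have := L2_echar k%:Z => ?; sl2.
Qed.

Lemma fcoef_partial_sum F N n :
  fcoef (partial_sum F N) n = if (0 <= n) && (n < N%:Z) then fcoef F n else 0.
Proof.
elim: N => [|N IH].
  rewrite (_ : partial_sum F 0 = fun t => 0 * 1); last first.
    by apply/funext => t; rewrite /partial_sum big_ord0 mul0r.
  rewrite fcoefZ ?mul0r; last exact: L2_cst.
  by rewrite leNgt; case: ltP.
have LN := L2_echar N%:Z; have LS := L2_partial_sum F N.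
rewrite partial_sumS fcoefD//; last by sl2.
rewrite fcoefZ// fcoef_echar IH.
case: n {IH} => n; last by rewrite mulr0 addr0.
rewrite !lez_nat !ltz_nat eqz_nat /= ltnS.
by case: ltngtP => [nN|nN|->]; rewrite ?mulr0 ?mulr1 ?addr0 ?add0r.
Qed.

Lemma ip_partial_sum_r h F N : L2 h -> (forall k, (k < N)%N -> ip h (echar k%:Z) = 0) ->
  ip h (partial_sum F N) = 0.
Proof.
move=> Lh h0; rewrite (@ip_sumr _ (fun k t => fcoef F k%:Z * echar k%:Z t))//; last first.
  by move=> k; have := L2_echar k%:Z => ?; sl2.
rewrite big1// => k _; rewrite ipZr//; last exact: L2_echar.
by rewrite h0 ?mulr0.
Qed.

(** Pythagoras: [F - S_M] is orthogonal to the characters of index in [[0, M[], hence to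
    [S_M - S_N]. *)
Lemma sqnorm_partial_sumB F N M : L2 F -> (N <= M)%N ->
  sqnorm (fun t => partial_sum F M t - partial_sum F N t) =
  sqnorm (fun t => F t - partial_sum F N t) - sqnorm (fun t => F t - partial_sum F M t).
Proof.
move=> LF NM; have LM := L2_partial_sum F M; have LN := L2_partial_sum F N.
have LFM : L2 (fun t => F t - partial_sum F M t) by sl2.
have orth k : (k < M)%N -> ip (fun t => F t - partial_sum F M t) (echar k%:Z) = 0.
  move=> kM; rewrite -/(fcoef _ _) fcoefD//; last by sl2.
  by rewrite fcoefN// fcoef_partial_sum lez_nat ltz_nat kM subrr.
have orth2 : ip (fun t => F t - partial_sum F M t)
    (fun t => partial_sum F M t + (-1) * partial_sum F N t) = 0.
  rewrite ipDr//; last by sl2.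
  rewrite ipZr// !ip_partial_sum_r ?mulr0 ?addr0// => k kN.
  by apply: orth; exact: leq_trans NM.
have := sqnormD LFM (_ : L2 (fun t => partial_sum F M t + (-1) * partial_sum F N t)).
rewrite orth2 mulr0 addr0 => /(_ ltac:(sl2)) h.
rewrite (_ : (fun t => F t - partial_sum F N t) = (fun t => F t - partial_sum F M t +
  (partial_sum F M t + -1 * partial_sum F N t))) ?h; last by apply/funext => t; ring.
rewrite [RHS]addrC addKr; congr sqnorm; apply/funext => t; ring.
Qed.

(** The squared distances [d n] from [F] to its partial sums decrease and are nonnegative, so they
    converge; their differences are the squared distances between partial sums. *)
Lemma partial_sum_cauchy F : L2 F -> forall e, 0 < e -> exists N, forall n m,
  (N <= n)%N -> (N <= m)%N -> sqnorm (fun t => partial_sum F n t - partial_sum F m t) <= e.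
Proof.
move=> LF e e0; pose d n := sqnorm (fun t => F t - partial_sum F n t).
have dB n m : (n <= m)%N -> sqnorm (fun t => partial_sum F m t - partial_sum F n t) = d n - d m.
  exact: sqnorm_partial_sumB.
have dd n m : (n <= m)%N -> d m <= d n by move=> nm; rewrite -subr_ge0 -dB// sqnorm_ge0.
have cd : cvgn d.
  apply: nonincreasing_is_cvgn => //; exists 0 => _ [n _ <-]; exact: sqnorm_ge0.
have ld n : limn d <= d n by apply: nonincreasing_cvgn_ge.
have /cvgrPdist_le /(_ e e0) [N _ NP] := cd.
have key n m : (N <= n)%N -> (n <= m)%N ->
    sqnorm (fun t => partial_sum F m t - partial_sum F n t) <= e.
  move=> Nn nm; rewrite dB//; have := NP n Nn; rewrite /= ler_norml => /andP[h _].
  by have := ld m; lra.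
exists N => n m Nn Nm; have [nm|/ltnW nm] := leqP m n; first exact: key.
rewrite -sqnormN (_ : (fun t => - _) = (fun t => partial_sum F m t - partial_sum F n t)).
  exact: key.
by apply/funext => t; ring.
Qed.

(** [f] is the L^2 limit of the partial sums. Each coefficient is continuous for the L^2 norm and is
    eventually constant along the partial sums. *)
Lemma riesz_projection F : L2 F -> exists f, H2 f /\
  (forall n, 0 <= n -> fcoef f n = fcoef F n) /\
  (forall e, 0 < e -> exists N, sqnorm (fun t => f t - partial_sum F N t) <= e).
Proof.
move=> LF; have [f [Lf fP]] := L2_complete (L2_partial_sum F) (partial_sum_cauchy LF).
have lim n (z : C) (K : nat) : (forall N, (K <= N)%N -> fcoef (partial_sum F N) n = z) ->
    fcoef f n = z.
  move=> Kz; apply/eqP; rewrite -subr_eq0; apply/eqP/(@csq_le_eq0 _ 1) => e e0.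
  have [N NP] := fP e e0; rewrite mulr1; apply: le_trans (NP (maxn K N) (leq_maxr _ _)).
  have LS := L2_partial_sum F (maxn K N).
  have L : L2 (fun t => f t - partial_sum F (maxn K N) t) by sl2.
  apply: le_trans (fcoef_le n L); rewrite fcoefD//; last by sl2.
  by rewrite fcoefN// (Kz (maxn K N)) ?leq_maxl.
exists f; split; [split => //|split].
- move=> n n0; apply: (lim n 0 0%N) => N _.
  by rewrite fcoef_partial_sum leNgt n0.
- case=> // n _; apply: (lim _ _ n.+1) => N nN.
  by rewrite fcoef_partial_sum lez_nat ltz_nat nN.
- by move=> e /fP[N NP]; exists N; exact: NP.
Qed.

Lemma H2_eq f g : H2 f -> H2 g -> (forall n, 0 <= n -> fcoef f n = fcoef g n) ->
  ae_circ (fun t => f t = g t).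
Proof.
move=> [Lf f0] [Lg g0] fg.
have h : ae_circ (fun t => f t - g t = 0).
  apply: fourier_unique; first by sl2.
  move=> n; rewrite fcoefD//; last by sl2.
  rewrite fcoefN//; have [n0|n0] := leP 0 n; first by rewrite fg// subrr.
  by rewrite f0// g0// subrr.
by apply: ae_circ_sub h _ => t /eqP; rewrite subr_eq0 => /eqP.
Qed.

(** An element of H^2 has the same coefficients as its own Riesz projection, hence is equal to it
    almost everywhere. *)
Lemma H2_density g : H2 g -> forall e, 0 < e ->
  exists N, sqnorm (fun t => g t - partial_sum g N t) <= e.
Proof.
move=> Hg e e0; have [f [Hf [fg fP]]] := riesz_projection Hg.1.
have [N NP] := fP e e0; exists N; apply: le_trans NP.
have LS := L2_partial_sum g N; have [Lf _] := Hf; have [Lg _] := Hg.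
rewrite (@sqnorm_ae _ (fun t => f t - partial_sum g N t))//; [by sl2|by sl2|].
by apply: ae_circ_sub (H2_eq Hf Hg fg) _ => t ->.
Qed.

(** For [n < 0], coefficient [n] of [f g] is [<g, conj f e_n>]. It vanishes when [g] is replaced by
    a partial sum, because only coefficients [n - k < 0] of [f] occur; Cauchy-Schwarz bounds the
    contribution of the remainder. *)
Lemma H2_mul f g : Hinf f -> H2 g -> H2 (fun t => f t * g t).
Proof.
move=> [If f0] Hg; have [Lg _] := Hg; split; first by sl2.
move=> n n0; apply: (@csq_le_eq0 _ (sqnorm f)) => e e0.
have [N NP] := H2_density Hg e0.
have LS := L2_partial_sum g N; have Lf := Linf_L2 If; have Ie := @Linf_echar R n.
have Le := L2_echar n.
have LcS : L2 (fun t => conjc (f t) * echar n t) by sl2.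
have LgS : L2 (fun t => g t - partial_sum g N t) by sl2.
have p0 : ip (partial_sum g N) (fun t => conjc (f t) * echar n t) = 0.
  rewrite ipC// ip_partial_sum_r ?conjc0// => k _.
  rewrite (ipC LcS (L2_echar _)) (_ : ip _ _ = fcoef f (n - k%:Z)).
    by rewrite f0 ?conjc0// subr_lt0 (lt_le_trans n0).
  rewrite -fcoef_shift /fcoef !ipE; apply: eq_mean => t.
  by rewrite [in LHS]conjM conjcK mulrA.
have -> : fcoef (fun t => f t * g t) n =
    ip (fun t => g t - partial_sum g N t) (fun t => conjc (f t) * echar n t).
  transitivity (ip g (fun t => conjc (f t) * echar n t)).
    by rewrite /fcoef !ipE; apply: eq_mean => t; rewrite [in RHS]conjM conjcK; ring.
  rewrite -[LHS]subr0 -p0 -mulN1r -ipZl// -ipDl//; last by sl2.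
  by apply: eq_ip => t //; rewrite mulN1r.
apply: le_trans (cauchy_schwarz LgS LcS) _.
rewrite ler_pM ?sqnorm_ge0// le_eqVlt; apply/orP; left; apply/eqP.
rewrite /sqnorm; congr (_ * _); apply: eq_Rintegral => t _.
by rewrite csqM csqJ csq_echar mulr1.
Qed.

(** The antianalytic part is obtained by projecting [conj (z F)]: its coefficient of index [m >= 0]
    is the conjugate of the coefficient of index [-m-1] of [F]. Uniqueness then identifies [F] with
    the sum. *)
Lemma L2_decomposition F : L2 F -> exists f u, H2 f /\ H2 u /\
  ae_circ (fun t => F t = f t + conjc (echar 1 t * u t)).
Proof.
move=> LF; have I1 := @Linf_echar R (-1); have I1' := @Linf_echar R 1.
have LG : L2 (fun t => echar (-1) t * conjc (F t)) by sl2.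
have [f [Hf [fP _]]] := riesz_projection LF.
have [u [Hu [uP _]]] := riesz_projection LG.
have [Lf f0] := Hf; have [Lu u0] := Hu.
exists f, u; split => //; split => //.
have Leu : L2 (fun t => conjc (echar 1 t * u t)) by sl2.
suff h : ae_circ (fun t => F t - (f t + conjc (echar 1 t * u t)) = 0).
  by apply: ae_circ_sub h _ => t /eqP; rewrite subr_eq0 => /eqP.
apply: fourier_unique => [|n]; first by sl2.
rewrite fcoefD//; last by sl2.
rewrite fcoefN; last by sl2.
rewrite fcoefD// fcoefJ; last by sl2.
rewrite fcoef_shift; have [n0|n0] := leP 0 n.
  rewrite fP// u0 ?conjc0 ?addr0 ?subrr//; lia.
rewrite f0// add0r uP; last by lia.
rewrite fcoef_shift fcoefJ// conjcK.
by rewrite (_ : - _ = n) ?subrr//; lia.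
Qed.

End HardySpace.

(** * Algebraic closure properties of H^2 and H^infty *)

Section Closure.
Local Open Scope classical_set_scope.
Local Open Scope ring_scope.
Context {R : realType}.
Local Notation C := R[i].
Implicit Types (f g : R -> C).

Lemma H2_add f g : H2 f -> H2 g -> H2 (fun t => f t + g t).
Proof.
move=> [Lf f0] [Lg g0]; split=> [|n n0]; first exact: L2_add.
by rewrite fcoefD// f0// g0// addr0.
Qed.

Lemma H2_opp f : H2 f -> H2 (fun t => - f t).
Proof.
by move=> [Lf f0]; split=> [|n n0]; [exact: L2_opp|rewrite fcoefN// f0// oppr0].
Qed.

Lemma H2_mulr f g : H2 f -> Hinf g -> H2 (fun t => f t * g t).
Proof. by move=> ? ?; under eq_fun do rewrite mulrC; exact: H2_mul. Qed.

Lemma Hinf_H2 f : Hinf f -> H2 f.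
Proof. by move=> [/Linf_L2 ? ?]. Qed.

Lemma Hinf_mul f g : Hinf f -> Hinf g -> Hinf (fun t => f t * g t).
Proof.
move=> Hf Hg; have [_ h] := H2_mul Hf (Hinf_H2 Hg).
by split => //; apply: Linf_mul; [case: Hf|case: Hg].
Qed.

Lemma Hinf_add f g : Hinf f -> Hinf g -> Hinf (fun t => f t + g t).
Proof.
move=> Hf Hg; have [_ h] := H2_add (Hinf_H2 Hf) (Hinf_H2 Hg).
by split => //; apply: Linf_add; [case: Hf|case: Hg].
Qed.

Lemma Hinf_opp f : Hinf f -> Hinf (fun t => - f t).
Proof.
move=> Hf; have [_ h] := H2_opp (Hinf_H2 Hf).
by split => //; apply: Linf_opp; case: Hf.
Qed.

Lemma Hinf_echar n : 0 <= n -> Hinf (@echar R n).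
Proof.
move=> n0; split=> [|m m0]; first exact: Linf_echar.
by rewrite fcoef_echar gt_eqF// (lt_le_trans m0).
Qed.

Lemma Hinf_cst (c : C) : Hinf (fun _ : R => c).
Proof.
split=> [|n n0]; first exact: Linf_cst.
have -> : (fun _ : R => c) = (fun t => c * echar 0 t).
  by apply/funext => t; rewrite echar0 mulr1.
by rewrite fcoefZ ?fcoef_echar ?gt_eqF ?mulr0//; exact: L2_echar.
Qed.

Lemma Hinf_exp f m : Hinf f -> Hinf (fun t => f t ^+ m).
Proof.
move=> Hf; elim: m => [|m IH]; first by under eq_fun do rewrite expr0; exact: Hinf_cst.
by under eq_fun do rewrite exprS; exact: Hinf_mul.
Qed.

End Closure.

Ltac shinf := lazymatch goal with
  | |- Hinf (fun t => (@?f t + @?g t)%R) => apply: (@Hinf_add _ f g); shinf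
  | |- Hinf (fun t => (@?f t * @?g t)%R) => apply: (@Hinf_mul _ f g); shinf
  | |- Hinf (fun t => (- (@?f t))%R) => apply: (@Hinf_opp _ f); shinf
  | |- _ => solve [assumption | apply: Hinf_echar; done | apply: Hinf_cst]
  end.
Ltac sh2 := lazymatch goal with
  | |- H2 (fun t => (@?f t + @?g t)%R) => apply: (@H2_add _ f g); sh2
  | |- H2 (fun t => (@?f t * @?g t)%R) =>
      first [solve [apply: (@H2_mul _ f g); [shinf | sh2]]
            |solve [apply: (@H2_mulr _ f g); [sh2 | shinf]]]
  | |- H2 (fun t => (- (@?f t))%R) => apply: (@H2_opp _ f); sh2
  | |- _ => solve [assumption | apply: Hinf_H2; shinf]
  end.

(** * Szego kernels and analytic extension to the disk *)

Section Kernels.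
Local Open Scope classical_set_scope.
Local Open Scope ring_scope.
Context {R : realType}.
Local Notation C := R[i].
Local Notation T := (@circ R).
Implicit Types (f g F theta beta : R -> C).

Lemma sqnorm_le f (M : R) : cmeas f -> 0 <= M -> ae_circ (fun t => csq (f t) <= M) ->
  sqnorm f <= M.
Proof.
move=> mf M0 fM.
suff [] : L2 f /\ sqnorm f <= M by [].
apply: L2_of_integral_le => //.
(* [M] is written as the squared modulus of a constant function, so that both sides become integrals
   of the same shape. *)
have cM : csq ((Num.sqrt M)%:C%C : C) = M by rewrite csq_real sqr_sqrtr.
have LM := @L2_cst R (Num.sqrt M)%:C%C.
have sM : sqnorm (fun _ : R => (Num.sqrt M)%:C%C : C) = M.
  have := sqnormE (fun _ : R => (Num.sqrt M)%:C%C : C).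
  by rewrite ipE mean_cst csqE cM => /(congr1 (@cre R)).
have := integral_csq LM; rewrite sM => <-.
have n1 (h : R -> C) t : T t -> (0 <= (csq (h t))%:E)%E by rewrite lee_fin csq_ge0.
have m1 (h : R -> C) : cmeas h -> measurable_fun T (fun t => (csq (h t))%:E).
  by move=> mh; apply/measurable_EFinP; exact: measurable_csq.
have fM' : ae_circ (fun t => (csq (f t))%:E <= (csq ((Num.sqrt M)%:C%C : C))%:E)%E.
  by apply: ae_circ_sub fM _ => t; rewrite lee_fin cM.
have aeg := (ae_circE _).1 fM'.
by apply: ae_ge0_le_integral; solve [done | exact: n1 | exact: m1 | exact: m1 LM.1 | exact: aeg].
Qed.

Lemma one_sub_neq0 (x : C) : csq x < 1 -> 1 - x != 0.
Proof.
move=> x1; apply: contraTneq (csq1B_ge (lexx _) x1) => ->.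
by rewrite csq0 -ltNge exprn_gt0// divr_gt0// subr_gt0.
Qed.

(** With [r = 1 / (1 - c theta)], one has [theta^m r = theta^m + c theta^(m+1) r], where [theta^m]
    has no negative coefficients. Iterating, a negative coefficient of [r] is [c^m] times a quantity
    bounded in [m], hence 0. The geometric series itself is never summed. *)
Lemma Hinf_geometric theta (c : C) : Hinf theta -> ae_circ (fun t => csq (theta t) <= 1) ->
  csq c < 1 -> Hinf (fun t => (1 - c * theta t)^-1).
Proof.
move=> Ht t1 c1; set q := csq c; pose d := ((1 - q) / 2) ^+ 2.
have q0 : 0 <= q := csq_ge0 _.
have d0 : 0 < d by rewrite exprn_gt0// divr_gt0// subr_gt0.
have It := Ht.1; have [mt _] := It.
pose r t := (1 - c * theta t)^-1.
have ctq : ae_circ (fun t => csq (c * theta t) <= q).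
  by apply: ae_circ_sub t1 _ => t h; rewrite csqM ler_piMr.
have rd : ae_circ (fun t => csq (r t) <= d^-1).
  apply: ae_circ_sub ctq _ => t h; rewrite csqV lef_pV2 ?posrE//.
    exact: csq1B_ge.
  by apply: lt_le_trans d0 _; exact: csq1B_ge.
have Ir : Linf r.
  split; last by exists d^-1.
  apply: cmeas_inv; apply: cmeas_add; first exact: cmeas_cst.
  by apply: cmeas_opp; apply: cmeas_mul => //; exact: cmeas_cst.
split => // n n0.
have Im m : Linf (fun t => theta t ^+ m) by case: (Hinf_exp m Ht).
have bnd m : sqnorm (fun t => theta t ^+ m * r t) <= d^-1.
  apply: sqnorm_le; [by case: (Linf_mul (Im m) Ir)|by rewrite invr_ge0 ltW|].
  apply: ae_circ_sub2 t1 rd _ => t a b; rewrite csqM csqX -[leRHS]mul1r.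
  by rewrite ler_pM// ?exprn_ge0 ?csq_ge0// exprn_ile1// csq_ge0.
have step m : fcoef (fun t => theta t ^+ m * r t) n =
    c * fcoef (fun t => theta t ^+ m.+1 * r t) n.
  have Hm := Im m; have HmS := Im m.+1.
  rewrite -[RHS]add0r -((Hinf_exp m Ht).2 n n0) -fcoefZ; last by sl2.
  rewrite -fcoefD; [|by sl2|by sl2].
  apply: fcoef_ae; [by sl2|by sl2|].
  apply: ae_circ_sub ctq _ => t h; have := one_sub_neq0 (le_lt_trans h c1).
  by rewrite /r exprS => nz; field.
have pw m : fcoef r n = c ^+ m * fcoef (fun t => theta t ^+ m * r t) n.
  elim: m => [|m IH]; last by rewrite IH step exprSr mulrA.
  have r0 : (fun t => theta t ^+ 0 * r t) = r by apply/funext => t; rewrite expr0 mul1r.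
  by rewrite r0 expr0 mul1r.
apply: (@csq_le_eq0 _ _ d^-1) => e e0.
have cq : q ^+ m @[m --> \oo] --> (0 : R) by apply: cvg_expr; rewrite ger0_norm.
have /cvgrPdist_le /(_ e e0) [m _ /(_ m (leqnn m))] := cq.
rewrite /= sub0r normrN ger0_norm ?exprn_ge0// => qe.
rewrite -/r (pw m) csqM csqX ler_pM ?exprn_ge0 ?csq_ge0//.
by apply: le_trans (bnd m); apply: fcoef_le; have := Im m => ?; sl2.
Qed.

Definition szego (w : C) (t : R) : C := (1 - conjc w * ept t)^-1.

Lemma Hinf_szego (w : C) : disk w -> Hinf (szego w).
Proof.
move=> w1; apply: Hinf_geometric; first exact: Hinf_echar.
  by apply: ae_circT => t; rewrite csq_echar.
by rewrite csqJ.
Qed.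

Lemma szegoE (w : C) t : disk w -> szego w t = 1 + conjc w * (echar 1 t * szego w t).
Proof.
move=> w1; have : 1 - conjc w * ept t != 0.
  by apply: one_sub_neq0; rewrite csqM csqJ csq_echar mulr1.
by rewrite /szego /ept => nz; field.
Qed.

Lemma extE f (w : C) : ext f w = ip f (szego w). Proof. by []. Qed.

(** In [k_w = 1 + conj w z k_w] the last term has zero coefficient of index 0. *)
Lemma ip_cst_szego (w : C) : disk w -> ip (fun _ : R => 1) (szego w) = 1.
Proof.
move=> w1; have [Is s0] := Hinf_szego w1; have I1 := @Linf_echar R 1.
have Ls := Linf_L2 Is; have L1 := @L2_cst R 1.
suff f1 : fcoef (szego w) 0 = 1.
  rewrite (ipC L1 Ls) -[RHS]conjc1 -f1 /fcoef; congr (conjc _).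
  by apply: eq_ip => t //; rewrite echar0.
have -> : szego w = (fun t => 1 + conjc w * (echar 1 t * szego w t)).
  by apply/funext => t; exact: szegoE.
rewrite fcoefD//; last by sl2.
rewrite fcoefZ; last by sl2.
rewrite fcoef_shift s0// mulr0 addr0 -[RHS](fcoef_echar 0 0).
by apply: eq_fcoef => t; rewrite echar0.
Qed.

(* [(beta - beta(w)) conj k_w] is [z] times the bounded analytic function
   [(beta - beta(w)) / (z - w)]. *)
Lemma ext_mul beta g (w : C) : Hinf beta -> H2 g -> disk w ->
  ext (fun t => beta t * g t) w = ext beta w * ext g w.
Proof.
move=> Hb Hg w1; have [Is s0] := Hinf_szego w1; have [Ib b0] := Hb; have [Lg g0] := Hg.
set b := ext beta w.
pose E t := (beta t - b) * conjc (szego w t).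
have IE : Linf E by rewrite /E; slinf.
have Ie := @Linf_echar R (-1); have LE := Linf_L2 IE.
have Ls := Linf_L2 Is; have Lb := Linf_L2 Ib.
have Lc := @L2_cst R (- b); have L1 := @L2_cst R 1.
have E0 : fcoef E 0 = 0.
  transitivity (ip (fun t => beta t + (- b) * 1) (szego w)).
    by rewrite /fcoef !ipE; apply: eq_mean => t; rewrite echar0 conjc1 !mulr1.
  rewrite ipDl//; last by sl2.
  by rewrite ipZl// ip_cst_szego// mulr1 -extE subrr.
(* [szegoE] gives [E = (beta - b) + w conj z E], and [beta - b] has no negative coefficients.
   Starting from [E0], the recursion kills every coefficient of index at most 0. *)
have ES n : n < 0 -> fcoef E n = w * fcoef E (n + 1).
  move=> n0; have [_ Hbn] : Hinf (fun t => beta t - b) by shinf.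
  have -> : n + 1 = n - (- 1) by rewrite opprK.
  rewrite -[RHS]add0r -(Hbn n n0).
  rewrite -fcoef_shift -fcoefZ; last by sl2.
  rewrite -fcoefD; [|by sl2|by sl2].
  apply: eq_fcoef => t; rewrite /E {1}szegoE// conjD conjc1 conjM conjcK.
  by rewrite conjM -echarN; ring.
have En (m : nat) : fcoef E (- m%:Z) = 0.
  elim: m => [|m IH]; first by rewrite oppr0.
  have n0 : - m.+1%:Z < 0 by lia.
  have e : - m.+1%:Z + 1 = - m%:Z by lia.
  by rewrite (ES _ n0) e IH mulr0.
have Hq : Hinf (fun t => echar (-1) t * E t).
  split; first by slinf.
  move=> n n0; rewrite fcoef_shift opprK.
  have e : n + 1 = - (absz (n + 1))%:Z by lia.
  by rewrite e; exact: En.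
(* The product of [conj z E] and [g] is in H^2; its coefficient of index -1 is
   [<(beta - b) g, k_w>]. *)
have [_ /(_ (-1) isT)] := H2_mul Hq Hg.
have -> : fcoef (fun t => echar (-1) t * E t * g t) (-1) =
    ip (fun t => beta t * g t + (- b) * g t) (szego w).
  rewrite /fcoef !ipE; apply: eq_mean => t.
  have ee : echar (-1) t * conjc (echar (-1) t) = 1 :> C by rewrite csqE csq_echar.
  by rewrite -[RHS]mul1r -ee /E; ring.
rewrite ipDl//; [|by sl2|by sl2]; rewrite ipZl// -!extE mulNr => /eqP.
by rewrite subr_eq0 => /eqP.
Qed.

(** The extension is the power series with the coefficients of [F], which are peeled off one by one.
    [A n] says that the series with its first [n] terms removed and [w^n] factored out vanishes on
    the punctured disk: letting [w] tend to 0 gives coefficient [n], and dividing by [w] gives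
    [A (n + 1)]. *)
Lemma fcoef_eq0_of_ext F : L2 F -> (forall w, disk w -> ext F w = 0) ->
  forall n, 0 <= n -> fcoef F n = 0.
Proof.
move=> LF ext0.
pose A n := forall w : C, disk w -> w != 0 -> ip F (fun t => echar n t * szego w t) = 0.
have rec n (w : C) : disk w -> ip F (fun t => echar n t * szego w t) =
    fcoef F n + w * ip F (fun t => echar (n + 1) t * szego w t).
  move=> w1; have [Is s0] := Hinf_szego w1; have In := @Linf_echar R n.
  have In1 := @Linf_echar R (n + 1); have Ln := L2_echar n.
  have Ls := Linf_L2 Is.
  rewrite -[w in w * _]conjcK -ipZr//; last by sl2.
  rewrite /fcoef -ipDr//; last by sl2.
  by apply: eq_ip => t //; rewrite {1}szegoE// echarD; ring.
have Az n : A n -> fcoef F n = 0.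
  move=> An; apply: (@csq_le_eq0 _ _ (sqnorm F * 16)) => e e0.
  (* For [w = s <= 1/2], [csq1B_ge] with [q = 1/2] gives [|1 - conj w z|^2 >= 1/16], whence the
     constant 16; and [s <= e] with [s <= 1] gives [|w|^2 <= e]. *)
  pose s := Num.min e (1 / 2).
  have s0 : 0 < s by rewrite /s lt_min e0; lra.
  have s1 : s <= e by rewrite /s ge_min lexx.
  have s2 : s <= 1 / 2 by rewrite /s ge_min lexx orbT.
  pose w : C := s%:C%C.
  have cw : csq w = s ^+ 2 by rewrite csq_real.
  have w1 : disk w by rewrite /disk /= cw; nra.
  have w0 : w != 0 by apply: contraTneq s0 => /(congr1 (@cre R)) /= ->; rewrite ltxx.
  have [Is _] := Hinf_szego w1; have In1 := @Linf_echar R (n + 1).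
  have Lk : L2 (fun t => echar (n + 1) t * szego w t) by sl2.
  have k16 : sqnorm (fun t => echar (n + 1) t * szego w t) <= 16.
    apply: sqnorm_le => //; first by case: Lk.
    apply: ae_circT => t; rewrite csqM csq_echar mul1r csqV.
    rewrite -[leRHS]invrK lef_pV2 ?posrE ?invr_gt0//; last first.
      apply: lt_le_trans (csq1B_ge (lexx _) _); last first.
        by rewrite csqM csqJ csq_echar mulr1.
      by rewrite exprn_gt0// divr_gt0// subr_gt0 csqM csqJ csq_echar mulr1.
    apply: le_trans (csq1B_ge (q := 1 / 2) _ _); [|rewrite csqM csqJ csq_echar mulr1 cw; nra|lra].
    by rewrite le_eqVlt; apply/orP; left; apply/eqP; field.
  have := rec n w w1; rewrite (An w w1 w0) => /esym/eqP; rewrite addr_eq0 => /eqP ->.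
  rewrite csqN csqM cw; apply: ler_pM; rewrite ?sqr_ge0 ?csq_ge0//; first by nra.
  apply: le_trans (cauchy_schwarz LF Lk) _.
  by rewrite ler_wpM2l// sqnorm_ge0.
have AS n : A n -> A (n + 1).
  move=> An w w1 w0; have := rec n w w1; rewrite (An w w1 w0) (Az n An) add0r.
  by move=> /esym/eqP; rewrite mulf_eq0 (negbTE w0) => /eqP.
case=> // n _; apply: Az; elim: n => [|n IH].
  move=> w w1 _; rewrite -[RHS](ext0 w w1) extE; apply: eq_ip => t //.
  by rewrite echar0 mul1r.
by have := AS _ IH; rewrite (_ : n%:Z + 1 = n.+1%:Z)//; lia.
Qed.

End Kernels.

(** * Reproducing kernels of model spaces *)

Section ModelSpaces.
Local Open Scope classical_set_scope.
Local Open Scope ring_scope.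
Context {R : realType}.
Local Notation C := R[i].
Implicit Types (f g F beta : R -> C).

Lemma innerE beta : inner beta -> Hinf beta /\ ae_circ (fun t => beta t * conjc (beta t) = 1).
Proof. by move=> [Hb b1]; split => //; apply: ae_circ_sub b1 _ => t e; rewrite csqE e. Qed.

Lemma rkernelE beta (w : C) t :
  rkernel beta w t = (1 - conjc (ext beta w) * beta t) * szego w t.
Proof. by []. Qed.

Lemma Hinf_rkernel beta w : inner beta -> disk w -> Hinf (rkernel beta w).
Proof.
move=> [Hb _] w1; have Hs := Hinf_szego w1.
have -> : rkernel beta w = (fun t => (1 - conjc (ext beta w) * beta t) * szego w t) by [].
shinf.
Qed.

(** This is [P_beta F = P F - beta P (conj beta F)] evaluated at [w], with [P] the Riesz
    projection. *)
Lemma ip_rkernel beta F (w : C) : inner beta -> L2 F -> disk w ->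
  ip F (rkernel beta w) = ext F w - ext beta w * ext (fun t => conjc (beta t) * F t) w.
Proof.
move=> [[Ib _] _] LF w1; have [Is _] := Hinf_szego w1; have Ls := Linf_L2 Is.
have Lb := Linf_L2 Ib.
transitivity (ip (fun t => F t + (- ext beta w) * (conjc (beta t) * F t)) (szego w)).
  rewrite !ipE; apply: eq_mean => t; rewrite rkernelE conjM conjD conjN conjM conjcK conjc1.
  ring.
rewrite ipDl//; [|by sl2]; rewrite ipZl//; last by sl2.
by rewrite -!extE mulNr.
Qed.

Lemma ext_ae f g (w : C) : L2 f -> L2 g -> disk w -> ae_circ (fun t => f t = g t) ->
  ext f w = ext g w.
Proof.
move=> Lf Lg w1 fg; have [Is _] := Hinf_szego w1; have Ls := Linf_L2 Is.
apply: mean_ae; [by sint|by apply: integ_meas; sint|].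
by apply: ae_circ_sub fg _ => t ->.
Qed.

(** Since [conj beta beta = 1], both terms of [ip_rkernel] are [beta(w) g(w)], the first one by
    [ext_mul]. *)
Lemma ip_inner_mul_rkernel beta g (w : C) : inner beta -> H2 g -> disk w ->
  ip (fun t => beta t * g t) (rkernel beta w) = 0.
Proof.
move=> ib Hg w1; have [Hb b1] := innerE ib; have [Ib _] := Hb; have [Lg _] := Hg.
have Lb := Linf_L2 Ib.
rewrite ip_rkernel//; last by sl2.
rewrite (@ext_ae (fun t => conjc (beta t) * (beta t * g t)) g)//; first last.
- by apply: ae_circ_sub b1 _ => t e; rewrite mulrA [conjc _ * _]mulrC e mul1r.
- by sl2.
by rewrite ext_mul// subrr.
Qed.

Lemma Kinf_rkernel beta (w : C) : inner beta -> disk w -> Kinf beta (rkernel beta w).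
Proof.
move=> ib w1; have Hk := Hinf_rkernel ib w1; split; last by case: Hk.
split=> [|g Hg]; first exact: Hinf_H2.
have [Lk _] := Hinf_H2 Hk; have [[Ib _] _] := ib; have [Lg _] := Hg.
rewrite ipC//; last by sl2.
by rewrite ip_inner_mul_rkernel// conjc0.
Qed.

(** The pairing is the conjugate of the mean of [z u k_w], that is, of the coefficient of index -1
    of the H^2 function [u k_w]. *)
Lemma ext_conj_shift u (w : C) : H2 u -> disk w -> ext (fun t => conjc (echar 1 t * u t)) w = 0.
Proof.
move=> Hu w1; have Hs := Hinf_szego w1; have He := @Hinf_echar R 1 isT.
have [Lu _] := Hu; have [Is _] := Hs; have [Ie _] := He.
have [_ /(_ (0 - 1) isT)] : H2 (fun t => u t * szego w t) by sh2.
rewrite -fcoef_shift => f0; rewrite -[RHS]conjc0 -f0 /fcoef extE !ipE -mean_conj.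
  by apply: eq_mean => t; rewrite echar0 conjc1 mulr1 !conjM mulrA.
have L0 := @L2_echar R 0; have Ls := Linf_L2 Is.
sint.
Qed.

Lemma ext0E f : ext f 0 = fcoef f 0.
Proof.
by apply: eq_ip => t //; rewrite conjc0 mul0r subr0 invr1 echar0.
Qed.

Lemma disk0 : disk (0 : C).
Proof. by rewrite /disk /= csq0 ltr01. Qed.

Lemma rkernel0 beta t : rkernel beta 0 t = 1 - conjc (ext beta 0) * beta t.
Proof. by rewrite /rkernel conjc0 mul0r subr0 divr1. Qed.

(** With [b = beta(0)], [||beta - b||^2 = 1 - |b|^2]. This is nonnegative, and it is zero only if
    [beta] is almost everywhere the constant [b]. *)
Lemma csq_inner0_lt1 beta : inner beta -> nonconstant beta -> csq (ext beta 0) < 1.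
Proof.
move=> ib ncb; have [Hb b1] := innerE ib; have [Ib _] := Hb; have Lb := Linf_L2 Ib.
set b := ext beta 0.
have L1 := @L2_echar R 0.
have ibb : integ (fun t => beta t * conjc (beta t)) by sint.
have sb : sqnorm beta = 1.
  have := sqnormE beta; rewrite ipE (mean_ae ibb (cmeas_cst 1) b1) mean_cst.
  by move=> /(congr1 (@cre R)).
have Lbb : L2 (fun t => (- b) * echar 0 t) by sl2.
have := sqnormD Lb Lbb; rewrite sqnormZ// sqnorm_echar mulr1 csqN sb ipZr//.
rewrite -/(fcoef _ _) -ext0E -/b conjN mulNr creN [conjc b * b]mulrC csqE creR => e.
rewrite lt_neqAle; apply/andP; split; last first.
  by have := sqnorm_ge0 (fun t => beta t + (- b) * echar 0 t); rewrite e; lra.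
apply/negP => /eqP b2; apply: ncb; exists b.
have L : L2 (fun t => beta t + (- b) * echar 0 t) by sl2.
apply: ae_circ_sub (sqnorm_eq0 L _) _; first by rewrite e b2; ring.
by move=> t /eqP; rewrite echar0 mulr1 subr_eq0 => /eqP.
Qed.

(* [F - P_- F] and [beta v], with [v = P_+ (conj beta F)], have the same analytic
   extension. *)
Lemma decomposition_of_rkernel_orthogonal beta F : inner beta -> L2 F ->
  (forall w, disk w -> ip F (rkernel beta w) = 0) ->
  exists u v, H2 u /\ H2 v /\
    ae_circ (fun t => F t = conjc (echar 1 t * u t) + beta t * v t).
Proof.
move=> ib LF orth; have [Hb b1] := innerE ib; have [Ib _] := Hb.
have Lb := Linf_L2 Ib; have Ie := @Linf_echar R 1.
have LbF : L2 (fun t => conjc (beta t) * F t) by sl2.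
have [f [u [Hf [Hu Fe]]]] := L2_decomposition LF.
have [v [u2 [Hv [Hu2 bFe]]]] := L2_decomposition LbF.
have [Lf _] := Hf; have [Lu _] := Hu; have [Lv _] := Hv; have [Lu2 _] := Hu2.
have ext_dec G g k w : L2 G -> H2 g -> H2 k -> disk w ->
    ae_circ (fun t => G t = g t + conjc (echar 1 t * k t)) -> ext G w = ext g w.
  move=> LG Hg Hk w1 Ge; have [Lg _] := Hg; have [Lk _] := Hk.
  have [Is _] := Hinf_szego w1; have Ls := Linf_L2 Is.
  have Lc : L2 (fun t => conjc (echar 1 t * k t)) by sl2.
  rewrite (ext_ae LG (L2_add Lg Lc) w1 Ge) extE ipDl// -!extE.
  by rewrite ext_conj_shift// addr0.
exists u, v; split => //; split => //.
have Hbv : H2 (fun t => beta t * v t) by sh2.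
have [Lbv _] := Hbv.
suff fbv : ae_circ (fun t => f t = beta t * v t).
  by apply: ae_circ_sub2 Fe fbv _ => t -> ->; rewrite addrC.
apply: H2_eq => // n n0; apply/eqP; rewrite -subr_eq0 -fcoefN// -fcoefD//; last by sl2.
apply/eqP; apply: fcoef_eq0_of_ext n0; first by sl2.
move=> w w1; have [Is _] := Hinf_szego w1; have Ls := Linf_L2 Is.
have := orth w w1; rewrite ip_rkernel// (ext_dec _ _ _ _ LF Hf Hu w1 Fe).
rewrite (ext_dec _ _ _ _ LbF Hv Hu2 w1 bFe) -ext_mul// => <-.
rewrite !extE -mulN1r -ipZl// -ipDl//; last by sl2.
by apply: eq_ip => t //; rewrite mulN1r.
Qed.

End ModelSpaces.

(** * Symbols of the zero operator *)

Section ZeroOperators.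
Local Open Scope classical_set_scope.
Local Open Scope ring_scope.
Context {R : realType}.
Local Notation C := R[i].
Implicit Types (phi alpha beta : R -> C).

Lemma ATTO_zero_of_decomposition alpha beta phi h1 h2 : inner alpha -> inner beta ->
  L2 phi -> H2 h1 -> H2 h2 ->
  ae_circ (fun t => phi t = conjc (alpha t * h1 t) + beta t * h2 t) ->
  ATTO_zero alpha beta phi.
Proof.
move=> ia ib Lphi Hh1 Hh2 phiE f [[Hf fK] If] w w1.
have [[Ia _] _] := ia; have [Hb _] := ib; have [Ib _] := Hb.
have Hk := Hinf_rkernel ib w1; have [Ik _] := Hk; have Lk := Linf_L2 Ik.
(* Boundedness of [f] puts [h2 f] in H^2, so that [beta (h2 f)] is orthogonal to the kernel. *)
have Hif : Hinf f by split => //; case: Hf.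
have [Lh1 _] := Hh1; have [Lh2 _] := Hh2; have [Lf _] := Hf.
have L1 : L2 (fun t => conjc (alpha t * h1 t) * f t) by sl2.
have L2' : L2 (fun t => beta t * (h2 t * f t)) by sl2.
rewrite /ATTO /Pmodel.
transitivity (ip (fun t => conjc (alpha t * h1 t) * f t + beta t * (h2 t * f t))
    (rkernel beta w)).
  rewrite !ipE; apply: mean_ae; [by sint|by apply: integ_meas; sint|].
  by apply: ae_circ_sub phiE _ => t ->; ring.
rewrite ipDl// ip_inner_mul_rkernel//; last by sh2.
rewrite addr0 -[RHS](fK (fun t => h1 t * rkernel beta w t)); last by sh2.
rewrite !ipE; apply: eq_mean => t; rewrite !conjM; ring.
Qed.

(** [P (1 - a' A) (1 - b B')] is computed from each of the two equations and the results are
    compared. Here [P], [A], [B] are the values of [phi], [alpha], [beta], primes on [A], [B] and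
    [a] stand for conjugates, and [U = conj (z u)], [U1 = z u'], [V = v], [V1 = conj v']. *)
Lemma pointwise_identity (P A A' B B' U U1 V V1 a' b : C) :
  A * A' = 1 -> B * B' = 1 ->
  P * (1 - a' * A) = U + B * V -> P * (1 - b * B') = U1 + A' * V1 ->
  (B - b) * V - U1 * (1 - a' * A) = (A' - a') * V1 - U * (1 - b * B').
Proof.
move=> hA hB h1 h2; apply/eqP; rewrite -subr_eq0; apply/eqP.
transitivity ((U + B * V) * (1 - b * B') - (U1 + A' * V1) * (1 - a' * A) +
  b * V * (B * B' - 1) - a' * V1 * (A * A' - 1)); first by ring.
rewrite -h1 -h2 hA hB; ring.
Qed.

Lemma decomposition_of_ATTO_zero alpha beta phi :
  inner alpha -> nonconstant alpha -> inner beta -> nonconstant beta ->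
  L2 phi -> ATTO_zero alpha beta phi ->
  exists h1 h2, H2 h1 /\ H2 h2 /\
     ae_circ (fun t => phi t = conjc (alpha t * h1 t) + beta t * h2 t).
Proof.
move=> ia nca ib ncb Lphi A0.
have [Ha a1] := innerE ia; have [Hb b1] := innerE ib.
have [Ia _] := Ha; have [Ib _] := Hb.
have La := Linf_L2 Ia; have Lb := Linf_L2 Ib.
have alt := csq_inner0_lt1 ia nca; have blt := csq_inner0_lt1 ib ncb.
have Hka := Hinf_rkernel ia (disk0 (R := R)); have Hkb := Hinf_rkernel ib (disk0 (R := R)).
have [Ika _] := Hka; have [Ikb _] := Hkb.
have [a aE] : {a | a = ext alpha 0} by exists (ext alpha 0).
have [b bE] : {b | b = ext beta 0} by exists (ext beta 0).
rewrite -aE in alt; rewrite -bE in blt.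
have LF1 : L2 (fun t => phi t * rkernel alpha 0 t) by sl2.
have LF2 : L2 (fun t => conjc (phi t) * rkernel beta 0 t) by sl2.
have [|u [v [Hu [Hv E1]]]] := decomposition_of_rkernel_orthogonal ib LF1.
  by move=> w w1; apply: A0 => //; apply: Kinf_rkernel => //; exact: disk0.
have [|u' [v' [Hu' [Hv' E2]]]] := decomposition_of_rkernel_orthogonal ia LF2.
  move=> w w1; have [Ikw _] := Hinf_rkernel ia w1; have Lkw := Linf_L2 Ikw.
  have Lkb := Linf_L2 Ikb.
  (* The adjoint relation: pairing [conj phi k_0^beta] with [k_w^alpha] gives the conjugate of
     [A k_w^alpha] at 0. *)
  transitivity (conjc (ATTO alpha beta phi (rkernel alpha w) 0)); last first.
    by rewrite (A0 _ (Kinf_rkernel ia w1) 0 (disk0 (R := R))) conjc0.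
  rewrite /ATTO /Pmodel !ipE -mean_conj; last by sint.
  by apply: eq_mean => t; rewrite (conjM (phi t * _)) (conjM (phi t)) conjcK; ring.
have He := @Hinf_echar R 1 isT; have [Ie _] := He.
(* [p] is the left side of [pointwise_identity], and [q] is the conjugate of its right side; both
   are in H^2. *)
pose p t := (beta t - b) * v t - echar 1 t * (u' t * (1 - conjc a * alpha t)).
pose q t := (alpha t - a) * v' t - echar 1 t * (u t * (1 - conjc b * beta t)).
have Hp1 : H2 (fun t => (beta t - b) * v t) by sh2.
have Hp2 : H2 (fun t => u' t * (1 - conjc a * alpha t)) by sh2.
have Hq1 : H2 (fun t => (alpha t - a) * v' t) by sh2.
have Hq2 : H2 (fun t => u t * (1 - conjc b * beta t)) by sh2.
have Hp : H2 p := H2_add Hp1 (H2_opp (H2_mul He Hp2)).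
have Hq : H2 q := H2_add Hq1 (H2_opp (H2_mul He Hq2)).
have E : ae_circ (fun t => [/\ alpha t * conjc (alpha t) = 1, beta t * conjc (beta t) = 1,
    phi t * (1 - conjc a * alpha t) = conjc (echar 1 t * u t) + beta t * v t &
    phi t * (1 - b * conjc (beta t)) = echar 1 t * u' t + conjc (alpha t) * conjc (v' t)]).
  apply: ae_circ_sub2 (ae_circ_and a1 b1) (ae_circ_and E1 E2) _ => t [ha hb] [e1 e2].
  split => //; first by rewrite -e1 rkernel0 -aE.
  rewrite (_ : _ * _ = conjc (conjc (phi t) * rkernel beta 0 t)).
    by rewrite e2 conjD conjcK (conjM (alpha t)).
  by rewrite rkernel0 -bE (conjM (conjc _)) conjcK conjD conjN conjM conjcK conjc1.
have pq : ae_circ (fun t => p t = conjc (q t)).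
  apply: ae_circ_sub E _ => t [ha hb h1 h2].
  rewrite /p /q mulrA (pointwise_identity ha hb h1 h2).
  by rewrite !(conjM, conjD, conjN, conjcK, conjc1); ring.
(* Negative coefficients of [p] vanish since [p] is in H^2, positive ones since [p = conj q]. At
   index 0 the term with factor [z] contributes nothing, and [(beta - b) v] has value
   [(beta(0) - b) v(0) = 0]. *)
have p0 : ae_circ (fun t => p t = 0).
  have [Lp pn] := Hp; have [Lq qn] := Hq; apply: fourier_unique => // n.
  have [n0|n0|->] := ltgtP n 0; first exact: pn.
    rewrite (fcoef_ae n Lp (L2_conj Lq) pq) fcoefJ// qn ?conjc0//.
    by rewrite oppr_lt0.
  have [Lp1 _] := Hp1; have [Lp2 Hp2n] := Hp2; have [Lv _] := Hv.
  have Lp2' := L2_mull Ie Lp2.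
  rewrite fcoefD//; last exact: L2_opp.
  rewrite fcoefN// fcoef_shift Hp2n// subr0 -ext0E.
  have Hbb : Hinf (fun t => beta t - b) by shinf.
  rewrite (ext_mul Hbb Hv (disk0 (R := R))).
  rewrite [ext (fun t => beta t - b) 0](_ : _ = 0) ?mul0r//.
  have L0 := @L2_cst R (- b).
  rewrite ext0E fcoefD// -[fcoef beta 0]ext0E -bE.
  rewrite (_ : fcoef (fun=> - b) 0 = - b) ?subrr//.
  by rewrite /fcoef ipE -[RHS]mean_cst; apply: eq_mean => t; rewrite echar0 conjc1 mulr1.
have le1 beta' : inner beta' -> ae_circ (fun t => csq (beta' t) <= 1).
  by move=> [_ h]; apply: ae_circ_sub h _ => t ->.
have Hia : Hinf (fun t => (1 - conjc a * alpha t)^-1).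
  by apply: Hinf_geometric => //; [exact: le1|rewrite csqJ].
have Hib : Hinf (fun t => (1 - conjc b * beta t)^-1).
  by apply: Hinf_geometric => //; [exact: le1|rewrite csqJ].
exists (fun t => v' t * (1 - conjc b * beta t)^-1), (fun t => v t * (1 - conjc a * alpha t)^-1).
split; first by sh2.
split; first by sh2.
have nz : ae_circ (fun t => 1 - conjc a * alpha t != 0 /\ 1 - conjc b * beta t != 0).
  apply: ae_circ_sub2 (le1 _ ia) (le1 _ ib) _ => t ha hb.
  split; apply: one_sub_neq0; rewrite csqM csqJ.
    by apply: le_lt_trans alt; rewrite ler_piMr// csq_ge0.
  by apply: le_lt_trans blt; rewrite ler_piMr// csq_ge0.
apply: ae_circ_sub2 (ae_circ_and E p0) nz _ => t [[ha hb h1 h2] pt0] [na nb].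
have nb' : 1 - b * conjc (beta t) != 0.
  apply: contra_neq nb => /(congr1 conjc).
  by rewrite conjD conjN conjM conjcK conjc1 conjc0.
rewrite !conjM conjc_inv conjD conjN conjM conjcK conjc1.
(* After clearing denominators, [phi (1 - b conj beta)] is replaced by [z u' + conj (alpha v')];
   then [p = 0] trades [z u' (1 - conj a alpha)] for [(beta - b) v], which equals
   [beta v (1 - b conj beta)] because [|beta| = 1]. *)
apply: (mulIf na); apply: (mulIf nb').
rewrite mulrAC h2 mulrDl.
have -> : echar 1 t * u' t * (1 - conjc a * alpha t) = (beta t - b) * v t.
  by apply/esym/eqP; rewrite -subr_eq0 -mulrA; apply/eqP; exact: pt0.
have -> : (beta t - b) * v t = beta t * v t * (1 - b * conjc (beta t)).
  transitivity (beta t * v t - b * v t * (beta t * conjc (beta t))).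
    by rewrite hb; ring.
  ring.
by field; rewrite na nb'.
Qed.

End ZeroOperators.

Theorem theorem2p1 (R : realType) (alpha beta phi : R -> R[i]) :
  inner alpha -> nonconstant alpha ->
  inner beta -> nonconstant beta ->
  L2 phi -> ATTO_bounded alpha beta phi ->
  (ATTO_zero alpha beta phi <->
   exists h1 h2 : R -> R[i], H2 h1 /\ H2 h2 /\
     ae_circ (fun t => phi t = conjc (alpha t * h1 t) + beta t * h2 t)).
Proof.
move=> ia nca ib ncb Lphi _; split; first exact: decomposition_of_ATTO_zero.
by move=> [h1 [h2 [Hh1 [Hh2 phiE]]]]; exact: ATTO_zero_of_decomposition phiE.
Qed.
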